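(* Let $\mathcal{H}$ be a real Hilbert space, let $\mathcal{T}:\mathcal{H}\to 2^{\mathcal{H}}$ be a maximal monotone operator with $\mathcal{T}^{-1}(0)\neq\emptyset$, and let $\mathcal{M}$ be an admissible preconditioner for $\mathcal{T}$ with closed range such that $(\mathcal{M}+\mathcal{T})^{-1}$ is continuous. Suppose that $\mathcal{M}=\mathcal{C}\mathcal{C}^*$ is a decomposition of $\mathcal{M}$ with $\mathcal{C}:\mathcal{U}\to\mathcal{H}$ a bounded injective linear operator on a real Hilbert space $\mathcal{U}$. Let $w^0\in\mathcal{H}$, $\alpha\ge 2$, $\rho\in(0,2]$, and let $\{\bar w^k\}$, $\{\hat w^k\}$, $\{w^k\}$ be the sequences generated by the accelerated degenerate proximal point method (accelerated dPPM) described in the context. Then: (a) If $\alpha=2$, then $\{\bar w^k\}$ converges strongly to a fixed point $w^*=(\mathcal{M}+\mathcal{T})^{-1}\mathcal{C}\,\Pi_{\mathcal{C}^*\mathcal{T}^{-1}(0)}(\mathcal{C}^*w^0)$ in $\mathcal{T}^{-1}(0)$, where $\Pi_{\mathcal{C}^*\mathcal{T}^{-1}(0)}(\cdot)$ is the projection operator onto the closed convex set $\mathcal{C}^*\mathcal{T}^{-1}(0)$; moreover, if $\rho\in(0,2)$, then $\{w^k\}$ and $\{\hat w^k\}$ also converge strongly to $w^*$. (b) If $\alpha>2$, then $\{\bar w^k\}$ converges weakly to a point in $\mathcal{T}^{-1}(0)$ (a fixed point of $(\mathcal{M}+\mathcal{T})^{-1}\mathcal{M}$).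
   Context: $\mathcal{H}$ is a real Hilbert space with inner product $\langle\cdot,\cdot\rangle$ and norm $\|\cdot\|$; $\mathcal{T}^{-1}(0)=\{w\in\mathcal{H}: 0\in\mathcal{T}w\}$. Admissible preconditioner: an admissible preconditioner for $\mathcal{T}:\mathcal{H}\to 2^{\mathcal{H}}$ is a linear, bounded, self-adjoint, positive semidefinite operator $\mathcal{M}:\mathcal{H}\to\mathcal{H}$ such that $\widehat{\mathcal{T}}:=(\mathcal{M}+\mathcal{T})^{-1}\mathcal{M}$ is single-valued and has full domain. One has $\mathcal{T}^{-1}(0)=\operatorname{Fix}\widehat{\mathcal{T}}$. Decomposition: every linear, bounded, self-adjoint, positive semidefinite $\mathcal{M}$ can be written as $\mathcal{M}=\mathcal{C}\mathcal{C}^*$ with $\mathcal{C}:\mathcal{U}\to\mathcal{H}$ bounded, linear and injective for some real Hilbert space $\mathcal{U}$, where $\mathcal{C}^*:\mathcal{H}\to\mathcal{U}$ is the adjoint; if $\mathcal{M}$ has closed range then $\mathcal{C}^*$ is onto. Accelerated dPPM: given $w^0\in\mathcal{H}$, $\hat w^0=w^0$, $\alpha\ge 2$ and $\rho\in(0,2]$, for $k=0,1,\ldots$ set 1. $\bar w^k=\widehat{\mathcal{T}}w^k$; 2. $\hat w^{k+1}=(1-\rho)w^k+\rho\bar w^k$; 3. $w^{k+1}=w^k+\frac{\alpha}{2(k+\alpha)}(\hat w^{k+1}-w^k)+\frac{k}{k+\alpha}(\hat w^{k+1}-\hat w^k)$. *)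

(* Defs.v *)
From HB Require Import structures.
From mathcomp Require Import all_boot all_order all_algebra.
From mathcomp Require Import all_classical all_reals all_analysis.

Set Implicit Arguments.
Unset Strict Implicit.
Unset Printing Implicit Defensive.

Import Order.TTheory GRing.Theory Num.Theory.
Import numFieldNormedType.Exports.

Local Open Scope classical_set_scope.
Local Open Scope ring_scope.

(* Real Hilbert spaces: complete normed modules whose norm comes from a
   symmetric bilinear form (linearity in the second argument follows by
   symmetry, positive definiteness from that of the norm). *)
HB.mixin Record CompleteNormedModule_isHilbert (R : realType) H
    of CompleteNormedModule R H := {
  inner : H -> H -> R;
  innerC : forall x y : H, inner x y = inner y x;
  innerDl : forall x y z : H, inner (x + y) z = inner x z + inner y z;
  innerZl : forall (a : R) (x y : H), inner (a *: x) y = a * inner x y;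
  sqr_norm_inner : forall x : H, `|x| ^+ 2 = inner x x }.

#[short(type="hilbertType")]
HB.structure Definition Hilbert (R : realType) :=
  {H of CompleteNormedModule_isHilbert R H & CompleteNormedModule R H}.

Arguments inner {R s}.

(* A set-valued operator U -> 2^V is a function S : U -> set V, with graph
   {(x, y) | S x y}. *)
Section SetValued.
Context {U V W : Type}.

Definition single_graph (f : U -> V) : U -> set V := fun x => [set f x].

Definition sv_inv (S : U -> set V) : V -> set U := fun y => [set x | S x y].

Definition sv_comp (S : V -> set W) (S' : U -> set V) : U -> set W :=
  fun x => \bigcup_(y in S' x) S y.

Definition sv_dom (S : U -> set V) : set U := [set x | S x !=set0].

Definition single_valued (S : U -> set V) := forall x, is_subset1 (S x).

Definition sv_fix (S : U -> set U) : set U := [set x | S x x].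

End SetValued.

Definition sv_add {U : Type} {V : zmodType} (S S' : U -> set V) : U -> set V :=
  fun x => [set y + y' | y in S x & y' in S' x].

Definition zeros {U : Type} {V : zmodType} (S : U -> set V) : set U :=
  sv_inv S 0.

(* The domain may be a proper subset of U: S is single-valued there and
   continuous for the induced topology. *)
Definition sv_continuous {U V : topologicalType} (S : U -> set V) :=
  exists2 f : U -> V,
    forall x, sv_dom S x -> S x = [set f x] &
    {within sv_dom S, continuous f}.

Section HilbertDefs.
Context {R : realType}.
Implicit Types H U : hilbertType R.

Definition monotone {H} (T : H -> set H) :=
  forall x y u v, T x u -> T y v -> 0 <= inner (x - y) (u - v).

Definition maximal_monotone {H} (T : H -> set H) :=
  monotone T /\
  forall T' : H -> set H, monotone T' ->
    (forall x, T x `<=` T' x) -> forall x, T' x `<=` T x.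

(* For a linear map this is boundedness of the operator; see
   linear_boundedP. *)
Definition bounded_operator {H U} (A : {linear H -> U}) :=
  bounded_near A (nbhs (0 : H)).

Definition is_adjoint {H U} (A : U -> H) (A' : H -> U) :=
  forall u x, inner (A u) x = inner u (A' x).

Definition positive_semidefinite {H} (M : H -> H) :=
  forall x, 0 <= inner (M x) x.

(* (M + T)^-1 *)
Definition sum_inv {H} (M : H -> H) (T : H -> set H) : H -> set H :=
  sv_inv (sv_add (single_graph M) T).

(* (M + T)^-1 M *)
Definition precond_resolvent {H} (M : H -> H) (T : H -> set H) : H -> set H :=
  sv_comp (sum_inv M T) (single_graph M).

Definition admissible_preconditioner {H} (M : {linear H -> H})
    (T : H -> set H) :=
  [/\ bounded_operator M,
      is_adjoint M M,
      positive_semidefinite M,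
      single_valued (precond_resolvent M T) &
      sv_dom (precond_resolvent M T) = setT].

(* The set of nearest points of S; a singleton when S is nonempty, closed and
   convex. *)
Definition projection {H} (S : set H) (x : H) : set H :=
  [set p | S p /\ forall q, S q -> `|x - p| <= `|x - q|].

Definition weakly_cvg {H} (x : nat -> H) (l : H) :=
  forall v : H, inner (x n) v @[n --> \oo] --> inner l v.

Definition accelerated_dPPM {H} (M : H -> H) (T : H -> set H)
    (alpha rho : R) (w0 : H) (wbar what w : nat -> H) :=
  [/\ w 0%N = w0,
      what 0%N = w0,
      forall k, precond_resolvent M T (w k) = [set wbar k],
      forall k, what k.+1 = (1 - rho) *: w k + rho *: wbar k &
      forall k, w k.+1 = w k
        + (alpha / (2 * (k%:R + alpha))) *: (what k.+1 - w k)
        + (k%:R / (k%:R + alpha)) *: (what k.+1 - what k)].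

End HilbertDefs.

(* Main.v *)
(** Let [f] be the single-valued [(M + T)^-1]. As [C^*] is onto,
    [J = C^* f C] is a firmly nonexpansive map of [U] with
    [Fix J = C^* (T^-1 0)], and [u_k = C^* w_k] follows an accelerated
    Krasnoselskii-Mann scheme for [G = (1 - rho) I + rho J]. With
    [a = alpha - 1], [r_k = u_k - G u_k] and the anchor
    [z_k = ((k + a) u_k - k C^* (what_k)) / a], the scheme reads
    [z_(k+1) = z_k - (a - 1) / (2 a) r_k], and
      [a (k + a) <r_k, u_k - z_k> + k (k + a) / 2 |r_k|^2 + a^2 |z_k - p|^2]
    is nonincreasing for every [p] in [Fix J]. This gives [|r_k| = O(1 / k)]
    and, for [alpha > 2], [sum k |r_k|^2 < oo], whence [u_k - z_k] tends to [0].
    If [alpha = 2] the anchor is fixed: this is Halpern's iteration, which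
    converges strongly to the projection of [u_0]. If [alpha > 2], the difference
    of two such energies shows that [<z_k, p - q>] converges for all fixed points
    [p, q], so weak cluster points of [u_k] coincide.

    To pass from the weak convergence of [u_k] to that of [f (C u_k)] one needs
    the latter to be bounded. Since [f] is continuous on its whole domain, it is
    bounded near [M x0] for a zero [x0] of [T], and maximality (through Minty's
    theorem) makes a ball around [M x0] part of the domain; monotonicity of [f]
    then bounds [f (C u)] on bounded sets of [u]. Weak compactness is replaced
    throughout by limits along ultrafilters. *)
Require Import Defs.
From mathcomp Require Import all_boot all_order all_algebra.
From mathcomp Require Import all_classical all_reals all_analysis.
From mathcomp Require Import ring lra.

Set Implicit Arguments.
Unset Strict Implicit.
Unset Printing Implicit Defensive.

Import Order.TTheory GRing.Theory Num.Theory.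
Import numFieldNormedType.Exports.

Local Open Scope classical_set_scope.
Local Open Scope ring_scope.
(** * Hilbert spaces: minimization, weak limits along ultrafilters, projection *)

Section InnerProduct.
Context {R : realType} {H : hilbertType R}.
Implicit Types x y z : H.

Lemma innerDr x y z : inner x (y + z) = inner x y + inner x z.
Proof. by rewrite innerC innerDl !(innerC x). Qed.

Lemma innerZr (a : R) x y : inner x (a *: y) = a * inner x y.
Proof. by rewrite innerC innerZl innerC. Qed.

Lemma innerNl x y : inner (- x) y = - inner x y.
Proof. by rewrite -scaleN1r innerZl mulN1r. Qed.

Lemma innerNr x y : inner x (- y) = - inner x y.
Proof. by rewrite innerC innerNl innerC. Qed.

Lemma inner0l x : inner 0 x = 0.
Proof. by rewrite -(scale0r 0) innerZl mul0r. Qed.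

Lemma inner0r x : inner x 0 = 0.
Proof. by rewrite innerC inner0l. Qed.

Definition innerE :=
  (@innerDl R H, innerDr, innerNl, innerNr, @innerZl R H, innerZr,
   inner0l, inner0r).

Lemma inner_ge0 x : 0 <= inner x x.
Proof. by rewrite -sqr_norm_inner sqr_ge0. Qed.

Lemma inner_le0_eq0 x : inner x x <= 0 -> x = 0.
Proof.
move=> h; apply/eqP; rewrite -normr_eq0 -sqrf_eq0 sqr_norm_inner.
by rewrite eq_le h inner_ge0.
Qed.

Lemma inner_inj x y : (forall v, inner v x = inner v y) -> x = y.
Proof.
move=> h; apply/eqP; rewrite -subr_eq0; apply/eqP/inner_le0_eq0.
by rewrite innerDr innerNr h subrr.
Qed.

(** Expand [|t x + s y|^2 >= 0] at [t = |y|] and [s = |x|] or [s = - |x|], then divide by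
    [|x| |y|]. *)
Lemma CauchySchwarz_inner x y : `|inner x y| <= `|x| * `|y|.
Proof.
have h (t s : R) : 0 <= t ^+ 2 * `|x| ^+ 2 + 2 * t * s * inner x y
     + s ^+ 2 * `|y| ^+ 2.
  have := inner_ge0 (t *: x + s *: y).
  by rewrite !innerE (innerC y x) !sqr_norm_inner => h; nra.
have [x0|x0] := eqVneq `|x| 0.
  by move/eqP: x0; rewrite normr_eq0 => /eqP ->; rewrite inner0l !normr0 mul0r.
have [y0|y0] := eqVneq `|y| 0.
  by move/eqP: y0; rewrite normr_eq0 => /eqP ->; rewrite inner0r !normr0 mulr0.
have xy : 0 < `|x| * `|y| by rewrite mulr_gt0 ?lt0r ?x0 ?y0 /=.
rewrite ler_norml.
have := h `|y| `|x|; have := h `|y| (- `|x|).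
move=> h1 h2; apply/andP; split; rewrite -(ler_pM2l xy); nra.
Qed.

Lemma inner_le_norm x y : inner x y <= `|x| * `|y|.
Proof. exact: le_trans (ler_norm _) (CauchySchwarz_inner x y). Qed.

Lemma inner_cvg (T : Type) (F : set_system T) (FF : Filter F)
    (f g : T -> H) x y :
  f t @[t --> F] --> x -> g t @[t --> F] --> y ->
  inner (f t) (g t) @[t --> F] --> inner x y.
Proof.
move=> fx gy.
have polar (u v : H) : inner u v = 4^-1 * (`|u + v| ^+ 2 - `|u - v| ^+ 2).
  by rewrite !sqr_norm_inner !innerE (innerC v u); field.
under eq_fun do rewrite polar.
rewrite polar; apply: cvgM; first exact: cvg_cst.
apply: cvgB; rewrite ?expr2; under eq_fun do rewrite expr2.
  by apply: cvgM; apply: cvg_norm; exact: cvgD.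
by apply: cvgM; apply: cvg_norm; exact: cvgB.
Qed.

Lemma inner_cvgl (T : Type) (F : set_system T) (FF : Filter F)
    (f : T -> H) x y :
  f t @[t --> F] --> x -> inner (f t) y @[t --> F] --> inner x y.
Proof. by move=> fx; apply: inner_cvg => //; exact: cvg_cst. Qed.

End InnerProduct.

Section Minimization.
Context {R : realType}.

Lemma cvg_of_cauchy (V : completeNormedModType R) (x : nat -> V) :
  (forall e : R, 0 < e ->
     exists N, forall i j, (N <= i)%N -> (N <= j)%N -> `|x i - x j| < e) ->
  exists l : V, x n @[n --> \oo] --> l.
Proof.
move=> hx; suff /cauchy_cvgP cx : cauchy (x @ \oo).
  by exists (limn x).
apply/cauchy_ballP => e e0; have [N hN] := hx e e0.
rewrite near_map2; exists ([set n | (N <= n)%N], [set n | (N <= n)%N]) => /=.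
  by split; exists N.
by move=> [i j] /= [iN jN]; rewrite -ball_normE /=; exact: hN.
Qed.

(* [S x y c] is the epigraph of a closed function of [(x, y)] that is uniformly
   convex at midpoints; a pair of spaces takes the place of a product because
   [H * H] carries no instance of complete normed module. *)
Lemma uniformly_convex_min (V W : completeNormedModType R)
    (S : V -> W -> R -> Prop) (k m0 : R) :
  0 < k ->
  (exists x y c, S x y c) ->
  (forall x y c, S x y c -> m0 <= c) ->
  (forall x y c x' y' c', S x y c -> S x' y' c' ->
     S (2^-1 *: (x + x')) (2^-1 *: (y + y'))
       (2^-1 * (c + c') - k * (`|x - x'| ^+ 2 + `|y - y'| ^+ 2))) ->
  (forall (x : nat -> V) (y : nat -> W) (c : nat -> R) x0 y0 c0,
     (forall n, S (x n) (y n) (c n)) ->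
     x n @[n --> \oo] --> x0 -> y n @[n --> \oo] --> y0 ->
     c n @[n --> \oo] --> c0 -> S x0 y0 c0) ->
  exists x y c, S x y c /\ forall x' y' c', S x' y' c' -> c <= c'.
Proof.
move=> k0 [x1 [y1 [c1 S1]]] lb mid cl.
pose E := [set c | exists x y, S x y c].
have E0 : E !=set0 by exists c1, x1, y1.
have lE : has_lbound E by exists m0 => c [x [y /lb]].
have infE : has_inf E by [].
have ad n : exists t : V * W * R,
    S t.1.1 t.1.2 t.2 /\ t.2 < inf E + n.+1%:R^-1.
  have n0 : (0 : R) < n.+1%:R^-1 by rewrite invr_gt0.
  have [c [x [y Sc]] cl'] := inf_adherent n0 infE.
  by exists (x, y, c).
have [t ht] := choice ad.
have tS n : S (t n).1.1 (t n).1.2 (t n).2 by have [] := ht n.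
have tge n : inf E <= (t n).2.
  by apply: ge_inf => //; exists (t n).1.1, (t n).1.2.
have tle n : (t n).2 < inf E + n.+1%:R^-1 by have [] := ht n.
(* The midpoint of two near-minimizers has value at least [inf E], so uniform convexity forces them
   to be close. *)
have key (e : R) : 0 < e -> exists N, forall i j, (N <= i)%N -> (N <= j)%N ->
    `|(t i).1.1 - (t j).1.1| < e /\ `|(t i).1.2 - (t j).1.2| < e.
  move=> e0.
  have ke : 0 < k * e ^+ 2 by rewrite mulr_gt0 ?exprn_gt0.
  have /cvgrPdist_lt/(_ _ ke) [N _ hN] := @cvg_harmonic R.
  exists N => i j Ni Nj.
  have {hN} sm n : (N <= n)%N -> (n.+1%:R^-1 : R) < k * e ^+ 2.
    by move=> /hN /=; rewrite sub0r normrN ger0_norm.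
  have hm : inf E <= 2^-1 * ((t i).2 + (t j).2)
      - k * (`|(t i).1.1 - (t j).1.1| ^+ 2 + `|(t i).1.2 - (t j).1.2| ^+ 2).
    by apply: ge_inf => //; do 2!eexists; apply: mid; exact: tS.
  have := sm _ Ni; have := sm _ Nj; have := tle i; have := tle j.
  set p : R := `|_ - _| in hm *; set q : R := `|_ - _| in hm *.
  set ri : R := i.+1%:R^-1; set rj : R := j.+1%:R^-1 => h1 h2 h3 h4.
  have pq : p ^+ 2 + q ^+ 2 < e ^+ 2 by rewrite -(ltr_pM2l k0); lra.
  have p2 := sqr_ge0 p; have q2 := sqr_ge0 q.
  have lte (s : R) : 0 <= s -> s ^+ 2 < e ^+ 2 -> s < e.
    by move=> s0; rewrite ltr_pXn2r ?nnegrE // ltW.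
  by split; apply: lte => //; [exact: normr_ge0|lra|exact: normr_ge0|lra].
have [x0 cx] : exists l : V, (t n).1.1 @[n --> \oo] --> l.
  apply: cvg_of_cauchy => e /key [N hN].
  by exists N => i j Ni Nj; case: (hN i j).
have [y0 cy] : exists l : W, (t n).1.2 @[n --> \oo] --> l.
  apply: cvg_of_cauchy => e /key [N hN].
  by exists N => i j Ni Nj; case: (hN i j).
have ct : (t n).2 @[n --> \oo] --> inf E.
  apply: (@squeeze_cvgr _ _ _ _ (fun=> inf E) (fun n => inf E + n.+1%:R^-1)).
  - by near=> n; rewrite tge ltW ?tle.
  - exact: cvg_cst.
  - rewrite -[X in _ --> X]addr0.
    by apply: cvgD; [exact: cvg_cst|exact: cvg_harmonic].
exists x0, y0, (inf E); split; first exact: cl cx cy ct.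
by move=> x y c Sc; apply: ge_inf => //; exists x, y.
Unshelve. all: by end_near. Qed.

End Minimization.

(** * Ultrafilters, the Riesz representation and weak limits *)

Section Tools.
Context {R : realType}.

(** Optimality at the start of a segment: when [t A + t^2 B] bounds the increment of a minimized
    function, its slope at [0] is nonnegative. *)
Lemma first_variation_ge0 (A B : R) :
  (forall t, 0 < t <= 1 -> 0 <= t * A + t ^+ 2 * B) -> 0 <= A.
Proof.
move=> h; rewrite leNgt; apply/negP => A0.
have hB : 0 < B by have := h 1; rewrite ltr01 lexx => /(_ isT); lra.
have d0 : 0 < B - A by lra.
(* If [A < 0], this [t] lies in []0, 1]] and makes [t A + t^2 B] negative. *)
have tpos : 0 < - A / (B - A) by rewrite divr_gt0 // oppr_gt0.
have t1 : - A / (B - A) <= 1 by rewrite ler_pdivrMr //; lra.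
have := h (- A / (B - A)); rewrite tpos t1 => /(_ isT).
have -> : - A / (B - A) * A + (- A / (B - A)) ^+ 2 * B
  = (- A / (B - A)) * (- (A ^+ 2) / (B - A)) by field; rewrite gt_eqF.
rewrite leNgt pmulr_rlt0 // pmulr_llt0 ?invr_gt0 // oppr_lt0 exprn_even_gt0 //=.
by rewrite lt_eqF.
Qed.

(** If [A] is not in [F], the trace of [F] on the complement of [A] is proper, and an ultrafilter
    finer than it contains both [A] and its complement. *)
Lemma filter_ultra (I : Type) (F : set_system I) (FF : Filter F) (A : set I) :
  (forall G, UltraFilter G -> F `<=` G -> G A) -> F A.
Proof.
move=> h; apply: contrapT => nFA.
have PG : ProperFilter (within (~` A) F).
  split; last exact: within_filter.
  move=> hA; apply: nFA; have : F (fun i => (~` A) i -> set0 i) := hA.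
  by apply: filterS => i hi; apply: contrapT => /hi.
have [G [UG FG]] := ultraFilterLemma PG.
have GA : G A by apply: h => B FB; apply: FG; apply: filterS FB => i Bi _.
have GC : G (~` A) by apply: FG; rewrite /within /=; exact: filterE.
have : G (A `&` ~` A) by exact: filterI.
by rewrite setICr; exact: filter_not_empty.
Qed.

Lemma cvg_ultra (I : Type) (F : set_system I) (FF : Filter F)
    (y : I -> R) (l : R) :
  (forall G, UltraFilter G -> F `<=` G -> y i @[i --> G] --> l) ->
  y i @[i --> F] --> l.
Proof.
move=> h; apply/cvgrPdist_lt => e e0; apply: filter_ultra => G UG FG.
by have /cvgrPdist_lt/(_ _ e0) := h _ UG FG.
Qed.

Lemma bounded_ultra_cvg (I : Type) (F : set_system I) (UF : UltraFilter F)
    (y : I -> R) (K : R) :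
  (forall i, `|y i| <= K) -> exists l : R, y i @[i --> F] --> l.
Proof.
move=> hy.
have hc : compact `[- K, K]%classic by exact: segment_compact.
have UG : UltraFilter (y i @[i --> F]).
  split; first exact: fmap_proper_filter.
  move=> G PG FG; apply/seteqP; split => // A GA.
  have [//|FC] := in_ultra_setVsetC (y @^-1` A) UF.
  have GC : G (~` A) := FG (~` A) FC.
  have : G (A `&` ~` A) by exact: filterI.
  by rewrite setICr => /filter_not_empty.
have FK : F (y @^-1` `[- K, K]%classic).
  by apply: filterE => i /=; rewrite in_itv /= -ler_norml.
move: hc; rewrite compact_ultra => /(_ _ UG FK) [].
by move=> l [_ hl]; exists l.
Qed.

Context {H : hilbertType R}.
Implicit Types (P : {linear H -> H}) (x y v : H).

(** The minimizer of [<P x, x> / 2 - l x] represents [l], as the first variation vanishes there.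
    This covers Riesz's theorem ([P = id]) and the surjectivity of a coercive [P]. *)
Lemma coercive_riesz P (l : H -> R) (lam K : R) :
  0 < lam -> continuous P -> is_adjoint P P ->
  (forall x, lam * `|x| ^+ 2 <= inner (P x) x) ->
  (forall x y, l (x + y) = l x + l y) ->
  (forall (a : R) x, l (a *: x) = a * l x) ->
  (forall x, l x <= K * `|x|) ->
  exists x, forall y, inner (P x) y = l y.
Proof.
move=> lam0 Pc Psym Pcoer lD lZ lK.
have l0 : l 0 = 0 by rewrite -(scale0r (0 : H)) lZ mul0r.
have lN x : l (- x) = - l x by rewrite -scaleN1r lZ mulN1r.
have sym x y : inner (P x) y = inner (P y) x by rewrite Psym innerC.
have lc (x : nat -> H) x0 :
    x n @[n --> \oo] --> x0 -> l (x n) @[n --> \oo] --> l x0.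
  move=> hx.
  have d0 : `|K| * `|x n - x0| @[n --> \oo] --> (0 : R).
    rewrite -(mulr0 `|K|); apply: cvgM; first exact: cvg_cst.
    rewrite -(normr0 H); apply: cvg_norm; rewrite -(subrr x0).
    by apply: cvgB => //; exact: cvg_cst.
  apply/cvgrPdist_le => e e0.
  move/cvgrPdist_le: d0 => /(_ _ e0); apply: filterS => n.
  rewrite sub0r normrN ger0_norm ?mulr_ge0 //; apply: le_trans.
  have le1 z : l z <= `|K| * `|z|.
    by apply: le_trans (lK z) _; rewrite ler_wpM2r // ler_norm.
  rewrite -lN -lD ler_norml -lerN2 opprK -lN (distrC (x n)) le1 andbT.
  by rewrite -(normrN (x0 - x n)) le1.
(* The second variable is frozen at [0]. The constant [lam / 8] bounds the midpoint defect of
   [<P x, x> / 2], and the lower bound comes from completing the square. *)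
pose S (x y : H) (c : R) := y = 0 /\ 2^-1 * inner (P x) x - l x <= c.
have [|||||x [_ [m [[_ hx] hmin]]]] := @uniformly_convex_min R H H S
    (lam / 8) (- (K ^+ 2 / (2 * lam))); rewrite ?divr_gt0 //.
- by exists 0, 0, 0; split => //; rewrite linear0 inner0l l0; lra.
- move=> x _ c [_ hc]; apply: le_trans hc.
  apply: (@le_trans _ _ (2^-1 * (lam * `|x| ^+ 2) - K * `|x|)).
    rewrite -subr_ge0.
    have -> : 2^-1 * (lam * `|x| ^+ 2) - K * `|x| - - (K ^+ 2 / (2 * lam))
      = (lam * `|x| - K) ^+ 2 / (2 * lam) by field; rewrite gt_eqF.
    by rewrite divr_ge0 ?sqr_ge0 // mulr_ge0 // ltW.
  by apply: lerB => //; rewrite ler_pM2l.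
- move=> x _ c x' _ c' [-> h] [-> h']; split; first by rewrite addr0 scaler0.
  have := Pcoer (x - x'); rewrite linearB linearZ linearD /= !innerE lZ lD.
  by rewrite (sym x' x) subrr normr0; lra.
- move=> xn yn cn x0 y0 c0 hS hx hy hc; split.
    have yn0 : yn = fun=> 0 by apply/funext => n; case: (hS n).
    rewrite yn0 in hy; rewrite -(cvg_lim (@norm_hausdorff _ H) hy).
    by apply: cvg_lim; [exact: norm_hausdorff|exact: cvg_cst].
  pose g n := 2^-1 * inner (P (xn n)) (xn n) - l (xn n).
  have hg n : g n <= cn n by case: (hS n).
  apply: (@ler_cvg_to _ _ _ R g cn _ _ _ hc); last exact: nearW.
  have hP : P (xn n) @[n --> \oo] --> P x0 by apply: continuous_cvg hx; exact: Pc.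
  apply: cvgB; last exact: lc.
  by apply: cvgM; [exact: cvg_cst|exact: inner_cvg].
exists x => y.
have {hmin} pos z : 0 <= inner (P x) z - l z.
  apply: (@first_variation_ge0 _ (2^-1 * inner (P z) z)) => t _.
  have := hmin (x + t *: z) 0 _ (conj erefl (lexx _)).
  move=> /(le_trans hx).
  by rewrite linearD linearZ /= !innerE lD lZ (sym z x); lra.
have := pos y; have := pos (- y); rewrite innerNr lN => h1 h2.
by apply/eqP; rewrite eq_le; apply/andP; split; lra.
Qed.

(** Stands in for weak compactness: the limits of [<x_i, v>] form a bounded linear functional of
    [v], which Riesz's theorem represents. *)
Lemma weak_ultralimit (I : Type) (F : set_system I) (UF : UltraFilter F)
    (x : I -> H) (K : R) :
  (forall i, `|x i| <= K) ->
  exists l : H, forall v, inner (x i) v @[i --> F] --> inner l v.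
Proof.
move=> hx.
have bd v i : `|inner (x i) v| <= K * `|v|.
  by apply: le_trans (CauchySchwarz_inner _ _) _; rewrite ler_wpM2r.
have ex v : exists l : R, inner (x i) v @[i --> F] --> l.
  exact: bounded_ultra_cvg (bd v).
have [l hl] := choice ex.
have uniq (f : I -> R) (a b : R) :
    f i @[i --> F] --> a -> f i @[i --> F] --> b -> a = b.
  move=> ha hb.
  by rewrite -(cvg_lim (@Rhausdorff R) ha) (cvg_lim (@Rhausdorff R) hb).
have [|||||||z hz] := @coercive_riesz idfun l 1 K => //.
- by move=> y; exact: cvg_id.
- by move=> y; rewrite mul1r sqr_norm_inner.
- move=> y z; apply: (uniq (fun i => inner (x i) (y + z))) => //.
  by under eq_fun do rewrite innerDr; exact: cvgD.
- move=> a y; apply: (uniq (fun i => inner (x i) (a *: y))) => //.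
  by under eq_fun do rewrite innerZr; apply: cvgM => //; exact: cvg_cst.
- move=> y; apply: (cvgr_to_le (hl y)); apply: filterE => i.
  exact: le_trans (ler_norm _) (bd y i).
by exists z => v; rewrite (hz v).
Qed.

End Tools.

(** * Projection onto a closed convex set *)

Section Projection.
Context {R : realType} {H : hilbertType R}.
Variable K : set H.
Hypothesis Kconv : forall x y (t : R), K x -> K y -> 0 <= t <= 1 ->
  K ((1 - t) *: x + t *: y).

Lemma projection_exists w : K !=set0 -> closed K -> projection K w !=set0.
Proof.
move=> [k0 Kk0] cK.
pose S (x y : H) (c : R) := [/\ y = 0, K x & `|w - x| ^+ 2 <= c].
(* The constant [1 / 4] is that of the parallelogram law. *)
have [|||||x [_ [m [[_ Kx hx] hmin]]]] := @uniformly_convex_min R H H S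
    (1 / 4) 0; rewrite ?divr_gt0 //.
- by exists k0, 0, (`|w - k0| ^+ 2).
- by move=> x _ c [_ _]; apply: le_trans; rewrite sqr_ge0.
- move=> x _ c x' _ c' [-> Kx h] [-> Kx' h']; split.
  + by rewrite addr0 scaler0.
  + have -> : 2^-1 *: (x + x') = (1 - 2^-1) *: x + 2^-1 *: x'.
      by rewrite scalerDr; congr (_ *: _ + _); field.
    by apply: Kconv => //; lra.
  + move: h h'; rewrite subrr normr0 !sqr_norm_inner !innerE.
    by rewrite (innerC x w) (innerC x' w) (innerC x' x); lra.
- move=> xn yn cn x0 y0 c0 hS hx hy hc; split.
  + have yn0 : yn = fun=> 0 by apply/funext => n; case: (hS n).
    rewrite yn0 in hy; rewrite -(cvg_lim (@norm_hausdorff _ H) hy).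
    by apply: cvg_lim; [exact: norm_hausdorff|exact: cvg_cst].
  + by apply: (closed_cvg _ cK _ _ hx); apply: nearW => n; case: (hS n).
  + pose g n := `|w - xn n| ^+ 2.
    have hg n : g n <= cn n by case: (hS n).
    apply: (@ler_cvg_to _ _ _ R g cn _ _ _ hc); last exact: nearW.
    have gE n : g n = inner (w - xn n) (w - xn n) by rewrite /g sqr_norm_inner.
    rewrite sqr_norm_inner (_ : g = fun n => inner (w - xn n) (w - xn n)).
      by apply: inner_cvg; apply: cvgB => //; exact: cvg_cst.
    exact/funext.
exists x; split => // q Kq.
rewrite -(@ler_pXn2r _ 2) ?nnegrE // (le_trans hx) //.
by apply: (hmin q 0).
Qed.

(** Half the squared distance to [w] has nonnegative slope at [p] towards every [q] in [K]. *)
Lemma projection_inner_le0 w p : projection K w p ->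
  forall q, K q -> inner (w - p) (q - p) <= 0.
Proof.
move=> [Kp hp] q Kq.
rewrite -oppr_ge0.
apply: (@first_variation_ge0 _ _ (2^-1 * inner (q - p) (q - p))).
move=> t /andP[t0 t1].
have /hp : K ((1 - t) *: p + t *: q) by apply: Kconv => //; rewrite ltW.
rewrite -(@ler_pXn2r _ 2) ?nnegrE // !sqr_norm_inner.
have -> : w - ((1 - t) *: p + t *: q) = (w - p) - t *: (q - p).
  by apply: inner_inj => v; rewrite !innerE; ring.
move: (w - p) (q - p) => d e.
by rewrite !innerE (innerC e d); lra.
Qed.

Lemma projection_uniq w p p' : projection K w p -> projection K w p' -> p = p'.
Proof.
move=> hp hp'; have [Kp _] := hp; have [Kp' _] := hp'.
have := projection_inner_le0 hp Kp'; have := projection_inner_le0 hp' Kp.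
move=> h1 h2; apply/eqP; rewrite -subr_eq0; apply/eqP/inner_le0_eq0.
move: h1 h2; rewrite !innerE (innerC p' p).
by lra.
Qed.

End Projection.

(** * Minty's theorem and the domain of (M + T)^-1 *)

Section Minty.
Context {R : realType} {H : hilbertType R}.
Variable T : H -> set H.
Hypothesis maxT : maximal_monotone T.

(** Adjoining [(x, u)] to the graph keeps it monotone, so by maximality the pair is already
    there. *)
Lemma maximal_monotone_mem x u :
  (forall a b, T a b -> 0 <= inner (x - a) (u - b)) -> T x u.
Proof.
move=> h; have [monT maxT'] := maxT.
pose T' a := [set b | T a b \/ a = x /\ b = u].
apply: (maxT' T'); last by right.
  move=> a b c d [Tac|[-> ->]] [Tbd|[-> ->]].
  - exact: monT.
  - by rewrite -opprB -(opprB u) innerNl innerNr opprK; exact: h.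
  - exact: h.
  - by rewrite subrr inner0l.
by move=> a b Tab; left.
Qed.

(* Minimizes the Fitzpatrick function of [T - y], taken at [(x, P v)], plus
   [(<P x, x> + <P v, v>) / 2]: the minimal value forces [v = - x]. *)
Lemma minty (P : {linear H -> H}) (lam : R) (y : H) :
  (exists a b, T a b) ->
  0 < lam -> continuous P -> is_adjoint P P ->
  (forall x, lam * `|x| ^+ 2 <= inner (P x) x) ->
  exists x, T x (y - P x).
Proof.
move=> [a0 [b0 Tab0]] lam0 Pc Psym Pcoer.
have [monT _] := maxT.
have sym x z : inner (P x) z = inner (P z) x by rewrite Psym innerC.
have PD u v : P (u + v) = P u + P v by rewrite linearD.
have PB u v : P (u - v) = P u - P v by rewrite linearB.
have PZ (a : R) u : P (a *: u) = a *: P u by rewrite linearZ.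
have Ponto z : exists v, P v = z.
  have [|||v hv] := @coercive_riesz _ _ P (fun x => inner z x) lam `|z|
    lam0 Pc Psym Pcoer.
  - by move=> *; rewrite innerDr.
  - by move=> *; rewrite innerZr.
  - by move=> x; exact: inner_le_norm.
  exists v; apply/eqP; rewrite -subr_eq0; apply/eqP/inner_le0_eq0.
  by rewrite innerDl innerNl hv subrr.
pose g a b x v := inner x (b - y) + inner a (P v) - inner a (b - y)
  + 2^-1 * inner (P x) x + 2^-1 * inner (P v) v.
pose S x v c := forall a b, T a b -> g a b x v <= c.
(* The Fitzpatrick function dominates the pairing: a smaller value would put [(x, P v + y)] in the
   graph, and testing [S] with that very pair is contradictory. *)
have Sge x v c : S x v c -> 2^-1 * inner (P (x + v)) (x + v) <= c.
  move=> hS; rewrite leNgt; apply/negP => hc.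
  have hin : T x (P v + y).
    apply: maximal_monotone_mem => a b /hS; rewrite /g.
    move: hc; rewrite linearD /= !innerE (sym x v) !(innerC (P v) x).
    by lra.
  have := hS _ _ hin; rewrite /g addrK.
  move: hc; rewrite linearD /= !innerE (sym x v) !(innerC (P v) x).
  by lra.
have [|||||x [v [m [hS hmin]]]] := @uniformly_convex_min R H H S (lam / 8) 0;
  rewrite ?divr_gt0 //.
- have [v hv] := Ponto (b0 - y).
  exists a0, v, (inner a0 (b0 - y) + 2^-1 * inner (P a0) a0
    + 2^-1 * inner (P v) v).
  move=> a b Tab; rewrite /g hv.
  have := monT _ _ _ _ Tab0 Tab; rewrite !innerE; lra.
- move=> x v c /Sge; apply: le_trans; rewrite mulr_ge0 //.
  by apply: le_trans (Pcoer _); rewrite mulr_ge0 ?sqr_ge0 // ltW.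
- move=> x v c x' v' c' h h' a b Tab.
  have := h _ _ Tab; have := h' _ _ Tab.
  have := Pcoer (x - x'); have := Pcoer (v - v').
  rewrite /g !PB !PZ !PD /= !innerE (sym x' x) (sym v' v).
  by lra.
- move=> xn vn cn x v c hS hx hv hc a b Tab.
  have hPx : P (xn n) @[n --> \oo] --> P x by apply: continuous_cvg hx; exact: Pc.
  have hPv : P (vn n) @[n --> \oo] --> P v by apply: continuous_cvg hv; exact: Pc.
  have hg n : g a b (xn n) (vn n) <= cn n by exact: hS.
  apply: (ler_cvg_to _ hc (nearW _ hg)).
  apply: cvgD; last by apply: cvgM; [exact: cvg_cst|exact: inner_cvg].
  apply: cvgD; last by apply: cvgM; [exact: cvg_cst|exact: inner_cvg].
  apply: cvgB; last exact: cvg_cst.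
  by apply: cvgD; apply: inner_cvg => //; exact: cvg_cst.
(* First variation of the minimum towards [(a, v')] with [P v' = b - y]; at that endpoint the
   Fitzpatrick function is at most [<a, b - y>] by monotonicity. *)
have key a b :
    T a b -> inner (P (x + v)) (x + v) <= inner (a + v) (b - y + P x).
  move=> Tab; have [v' hv'] := Ponto (b - y).
  suff : 0 <= inner a (b - y) - m - 2^-1 * inner (P x) x - 2^-1 * inner (P v) v
      + inner (P x) a + inner (P v') v.
    have := Sge _ _ _ hS; rewrite -hv' linearD /= !innerE.
    by rewrite (sym v x) (innerC v) (innerC a (P x)) (innerC v (P x)); lra.
  apply: (@first_variation_ge0 _ _
    (2^-1 * inner (P (a - x)) (a - x) + 2^-1 * inner (P (v' - v)) (v' - v))).
  move=> t /andP[t0 t1].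
  pose xt := (1 - t) *: x + t *: a; pose vt := (1 - t) *: v + t *: v'.
  have /hmin : S xt vt
     ((1 - t) * (m - 2^-1 * inner (P x) x - 2^-1 * inner (P v) v)
     + t * inner a (b - y) + 2^-1 * inner (P xt) xt + 2^-1 * inner (P vt) vt).
    move=> a' b' Tab'.
    have h1 : 0 <= (1 - t) * (m - g a' b' x v).
      by rewrite mulr_ge0 ?subr_ge0 // hS.
    have h2 : 0 <= t * inner (a - a') (b - b').
      by rewrite mulr_ge0 ?(ltW t0) // monT.
    rewrite /g; move: h1 h2; rewrite /g.
    set qx := inner (P xt) xt; set qv := inner (P vt) vt.
    rewrite /vt /xt PD !PZ /= hv' !innerE.
    by lra.
  rewrite /xt /vt !PB !PD !PZ /= !innerE.
  rewrite (sym a x) (sym v' v); lra.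
(* By [key], this pair is monotonically related to the graph; [key] applied to the pair itself then
   gives [x = - v]. *)
have hin : T (- v) (y - P x).
  apply: maximal_monotone_mem => a b /key.
  have : 0 <= inner (P (x + v)) (x + v).
    by apply: le_trans (Pcoer _); rewrite mulr_ge0 ?sqr_ge0 // ltW.
  move=> h1 h2; apply: le_trans (le_trans h1 h2) _.
  by rewrite !innerE; lra.
have vx : x + v = 0.
  have := key _ _ hin; rewrite addNr inner0l => h.
  have : lam * `|x + v| ^+ 2 <= 0 by exact: le_trans (Pcoer _) h.
  by rewrite (pmulr_rle0 _ lam0) sqr_norm_inner => /inner_le0_eq0.
have xv : x = - v by apply/eqP; rewrite -addr_eq0; apply/eqP.
by exists x; rewrite {1}xv.
Qed.

End Minty.

(** * Bounded operators and adjoints *)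

Lemma bounded_operator_le (R : realType) (H U : hilbertType R)
    (C : {linear U -> H}) :
  bounded_operator C -> exists2 d : R, 0 <= d & forall x, `|C x| <= d * `|x|.
Proof.
move=> /linear_boundedP[c [_ hc]]; exists (Num.max c 0 + 1).
  by rewrite addr_ge0 // le_max lexx orbT.
by apply: hc; rewrite ltr_pwDr // le_max lexx.
Qed.

Section Adjoint.
Context {R : realType} {H U : hilbertType R}.
Variables (C : {linear U -> H}) (Cstar : H -> U).
Hypotheses (Cbd : bounded_operator C) (adjC : is_adjoint C Cstar).

Lemma adjointD x y : Cstar (x + y) = Cstar x + Cstar y.
Proof. by apply: inner_inj => v; rewrite innerDr -!adjC innerDr. Qed.

Lemma adjointZ (a : R) x : Cstar (a *: x) = a *: Cstar x.
Proof. by apply: inner_inj => v; rewrite innerZr -!adjC innerZr. Qed.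

Lemma adjointN x : Cstar (- x) = - Cstar x.
Proof. by rewrite -scaleN1r adjointZ scaleN1r. Qed.

Lemma adjointB x y : Cstar (x - y) = Cstar x - Cstar y.
Proof. by rewrite adjointD adjointN. Qed.

Lemma inner_adjoint x u : inner (Cstar x) u = inner x (C u).
Proof. by rewrite innerC -adjC innerC. Qed.

Lemma adjoint_norm_le :
  exists2 c : R, 0 <= c & forall x, `|Cstar x| <= c * `|x|.
Proof.
have [d d0 hd] := bounded_operator_le Cbd.
exists d => // x.
have [->|x0] := eqVneq (Cstar x) 0; first by rewrite normr0 mulr_ge0.
have p : 0 < `|Cstar x| by rewrite normr_gt0.
rewrite -(ler_pM2l p) -expr2 sqr_norm_inner -adjC.
apply: le_trans (inner_le_norm _ _) _.
by rewrite mulrA (mulrC _ d) ler_wpM2r.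
Qed.

(** The residual [q] of projecting [C u] onto the range of [M] is orthogonal to that range, so
    [|Cstar q|^2 = <M q, q> = 0]. As [q] also lies in the range of [C], it vanishes, and injectivity
    concludes. *)
Lemma adjoint_onto (M : {linear H -> H}) :
  injective C -> (forall x, M x = C (Cstar x)) -> closed (range M) ->
  forall u, exists x, Cstar x = u.
Proof.
move=> injC hM clM u.
have conv (y z : H) (t : R) : range M y -> range M z -> 0 <= t <= 1 ->
    range M ((1 - t) *: y + t *: z).
  move=> [y' _ <-] [z' _ <-] _; exists ((1 - t) *: y' + t *: z') => //.
  by rewrite linearD !linearZ.
have ne : range M !=set0 by exists (M 0), 0.
have [p hp] := projection_exists conv (C u) ne clM.
have [[x _ px] _] := hp.
pose q := C u - p.
have hq z : inner q (M z) = 0.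
  have hle z' : inner q (M z') <= 0.
    have := projection_inner_le0 conv hp (q := p + M z').
    rewrite addrAC subrr add0r; apply.
    by exists (x + z') => //; rewrite linearD px.
  apply/eqP; rewrite eq_le hle /=.
  by have := hle (- z); rewrite linearN innerNr oppr_le0.
have cq : Cstar q = 0.
  by apply: inner_le0_eq0; rewrite -adjC -hM innerC hq.
have q0 : q = 0.
  apply: inner_le0_eq0; rewrite {1}/q -px hM innerDl innerNl !adjC cq.
  by rewrite !inner0r subrr.
exists x; apply: injC; rewrite -hM px.
by apply/eqP; rewrite eq_sym -subr_eq0; apply/eqP.
Qed.

End Adjoint.

(** * Domain and local boundedness of [(M + T)^-1] *)

Section Resolvent.
Context {R : realType} {H : hilbertType R}.
Variables (T : H -> set H) (M : {linear H -> H}).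
Hypotheses (maxT : maximal_monotone T) (Mbd : bounded_operator M).
Hypotheses (Msym : is_adjoint M M) (Mpsd : positive_semidefinite M).
Variable f : H -> H.
Hypothesis fP : forall z, sv_dom (sum_inv M T) z -> sum_inv M T z = [set f z].
Hypothesis fc : {within sv_dom (sum_inv M T), continuous f}.

Lemma mem_sum_inv z x : sum_inv M T z x <-> T x (z - M x).
Proof.
rewrite /sum_inv /sv_inv /sv_add /single_graph /=; split.
  by move=> [y -> [y' Ty' <-]]; rewrite addrAC subrr add0r.
by move=> h; exists (M x) => //; exists (z - M x) => //; rewrite addrC subrK.
Qed.

Lemma sum_inv_eq z x : T x (z - M x) -> f z = x.
Proof.
move=> /mem_sum_inv h; have dz : sv_dom (sum_inv M T) z by exists x.
by move: (h); rewrite (fP dz) /= => ->.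
Qed.

Lemma sum_inv_fun z : sv_dom (sum_inv M T) z -> T (f z) (z - M (f z)).
Proof. by move=> dz; apply/mem_sum_inv; rewrite (fP dz). Qed.

(* [f] is bounded on its domain near [M x0]; the solutions of
   [y \in lam x + M x + T x] given by Minty's theorem are values of [f] there,
   so they stay bounded as [lam] tends to [0], and a weak limit solves
   [y \in M x + T x]. *)
Lemma sum_inv_dom_nbhs x0 : T x0 0 ->
  exists2 r : R, 0 < r & exists K : R, forall y, `|y - M x0| < r ->
    sv_dom (sum_inv M T) y /\ `|f y| <= K.
Proof.
move=> Tx0; have [monT _] := maxT.
have MD u v : M (u + v) = M u + M v by rewrite linearD.
have MB u v : M (u - v) = M u - M v by rewrite linearB.
have dz0 : sv_dom (sum_inv M T) (M x0).
  by exists x0; apply/mem_sum_inv; rewrite subrr.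
pose K := `|f (M x0)| + 1.
have [r r0 hr] : exists2 r : R, 0 < r & forall z, sv_dom (sum_inv M T) z ->
    `|M x0 - z| < r -> `|f z| <= K.
  have := (subspace_continuousP _ _).1 fc _ dz0.
  move=> /cvgrPdist_lt/(_ _ ltr01).
  rewrite /within /= => /nbhs_ballP [r /= r0 hr].
  exists r => // z dz hz.
  have h1 : `|f (M x0) - f z| < 1 by apply: hr => //; rewrite -ball_normE.
  rewrite /K -lerBlDl; apply: le_trans (ltW h1).
  by rewrite distrC; exact: lerB_dist.
exists (r / 4); first by rewrite divr_gt0.
exists K => y hy.
(* Chosen so that [lam n |x0| <= r / 4]. The point [y - lam n x_n] then lies at distance at most
   [2 |y - M x0| + 2 lam n |x0| < r] from [M x0]. *)
pose lam0 : R := r / 4 / (`|x0| + 1).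
have x1 : 0 < `|x0| + 1 by rewrite ltr_wpDl.
have lam00 : 0 < lam0 by rewrite !divr_gt0.
pose lam n : R := lam0 * n.+1%:R^-1.
have lampos n : 0 < lam n by rewrite mulr_gt0 ?invr_gt0.
have lamle n : lam n * `|x0| <= r / 4.
  apply: (@le_trans _ _ (lam0 * `|x0|)).
    by rewrite ler_wpM2r // /lam ler_piMr ?(ltW lam00) // invf_le1 // ler1n.
  by rewrite /lam0 -mulrA ler_piMr ?divr_ge0 ?ltW // mulrC ltr_pdivrMr //; lra.
have lamc : lam n @[n --> \oo] --> (0 : R).
  by rewrite -(mulr0 lam0); apply: cvgM; [exact: cvg_cst|exact: cvg_harmonic].
have exn n : exists x, T x (y - lam n *: x - M x).
  pose P : {linear H -> H} := (lam n \*: (@idfun H)) \+ M.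
  have PE x : P x = lam n *: x + M x by [].
  have [|||||x hx] := @minty _ _ T maxT P (lam n) y.
  - by exists x0, 0.
  - exact: lampos.
  - move=> x; apply: cvgD; last by apply: (linear_bounded_continuous M).1.
    by apply: cvgZ; [exact: cvg_cst|exact: cvg_id].
  - by move=> u v; rewrite !PE !innerE Msym.
  - by move=> x; rewrite PE !innerE sqr_norm_inner lerDl Mpsd.
  by exists x; rewrite -addrA -opprD -PE.
have [x hx] := choice exn.
have xK n : `|x n| <= K.
  have Tx := hx n.
  have hz : T (x n) (y - lam n *: x n - M (x n)) by [].
  rewrite -(sum_inv_eq hz); apply: hr.
    by exists (x n); apply/mem_sum_inv.
  have := monT _ _ _ _ hz Tx0; rewrite subr0 => h.
  pose d := x n - x0.
  have h1 : lam n * `|d| ^+ 2 <= inner d (y - M x0 - lam n *: x0).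
    have := Mpsd d; move: h; rewrite -/d sqr_norm_inner.
    have -> : x n = d + x0 by rewrite /d subrK.
    rewrite MD; move: (d) => e.
    by rewrite !innerE (innerC (M e) e); lra.
  have h2 : lam n * `|d| <= `|y - M x0| + lam n * `|x0|.
    have [->|d0] := eqVneq d 0.
      by rewrite normr0 mulr0 addr_ge0 // mulr_ge0 // ltW.
    have dp : 0 < `|d| by rewrite normr_gt0.
    rewrite -(ler_pM2l dp).
    apply: (@le_trans _ _ (lam n * `|d| ^+ 2)); first by rewrite expr2; lra.
    apply: le_trans h1 _; apply: le_trans (inner_le_norm _ _) _.
    rewrite ler_pM2l //; apply: le_trans (ler_normB _ _) _.
    by rewrite normrZ (gtr0_norm (lampos n)).
  have h3 : `|lam n *: x n| <= lam n * `|d| + lam n * `|x0|.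
    rewrite normrZ (gtr0_norm (lampos n)) -mulrDr ler_pM2l //.
    by rewrite -{1}(subrK x0 (x n)); exact: ler_normD.
  rewrite distrC addrAC.
  have h4 := ler_normB (y - M x0) (lam n *: x n).
  have := lamle n; move: hy; lra.
have [G [UG FG]] := ultraFilterLemma (eventually_filter).
have [xl hxl] := weak_ultralimit UG xK.
have lamG : lam n @[n --> G] --> (0 : R) by move=> A /lamc hA; exact: FG.
suff Txl : T xl (y - M xl).
  have dy : sv_dom (sum_inv M T) y by exists xl; apply/mem_sum_inv.
  split => //; apply: hr => //; rewrite distrC.
  by apply: lt_trans hy _; lra.
apply: maximal_monotone_mem => // a b Tab.
(* Weak lower semicontinuity of the quadratic form is used as [2 <x_n - a, M (xl - a)> - q <= <x_n -
   a, M (x_n - a)>]; the term [lam n K'] absorbs the regularization. *)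
pose q := inner (xl - a) (M (xl - a)).
pose K' := (K + `|a|) * `|a|.
have lim1 v : inner (x n - a) v @[n --> G] --> inner (xl - a) v.
  under eq_fun do rewrite innerDl.
  by rewrite innerDl; apply: cvgD => //; exact: cvg_cst.
have : 2 * q - q <= inner (xl - a) (y - M a - b) + 0 * K'.
  apply: (@ler_cvg_to _ G _ R (fun n => 2 * inner (x n - a) (M (xl - a)) - q)
    (fun n => inner (x n - a) (y - M a - b) + lam n * K')).
  - apply: cvgB; last exact: cvg_cst.
    by apply: cvgM; [exact: cvg_cst|exact: lim1].
  - by apply: cvgD; [exact: lim1|apply: cvgM => //; exact: cvg_cst].
  apply: filterE => n.
  have h1 := monT _ _ _ _ (hx n) Tab.
  have h2 : 0 <= lam n * (K' + inner (x n - a) (x n)).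
    apply: mulr_ge0; first exact: ltW.
    have e1 : inner (x n - a) (x n)
        = inner (x n - a) (x n - a) + inner (x n - a) a.
      by rewrite -innerDr subrK.
    rewrite e1 addrCA addr_ge0 ?inner_ge0 //.
    have := CauchySchwarz_inner (x n - a) a; rewrite ler_norml => /andP[e2 _].
    have e3 : `|x n - a| * `|a| <= K'.
      rewrite ler_wpM2r //; apply: le_trans (ler_normB _ _) _.
      by rewrite lerD2r.
    by lra.
  have h3 := Mpsd (x n - xl).
  have e4 : x n - xl = (x n - a) - (xl - a) by rewrite opprB addrA subrK.
  have h4 : inner (x n - a) (y - lam n *: x n - M (x n) - b)
    = inner (x n - a) (y - M a - b) - lam n * inner (x n - a) (x n)
      - inner (x n - a) (M (x n - a)).
    by rewrite MB !(innerDr, innerNr, innerZr); lra.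
  rewrite h4 in h1; rewrite e4 in h3; rewrite /q.
  move: h1 h2 h3; move: (x n - a) (xl - a) => u w.
  rewrite MB !innerDl !innerNl !innerDr !innerNr !Msym (innerC u (M w)) Msym.
  rewrite (innerC w (M u)) Msym.
  by lra.
rewrite mul0r addr0 -subr_ge0 /q => h; apply: le_trans h _.
by rewrite MB !(innerDr, innerNr); lra.
Qed.

End Resolvent.
(** * The accelerated iteration of a nonexpansive map *)

Section Cesaro.
Context {R : realType}.

(** With [L = l + eta / 2], the quantity [(k + 1) (b k - L)] stops increasing once [eps k <= L], so
    [b k - L] is at most [O(1 / k)]. *)
Lemma cesaro_limsup_le (b eps : nat -> R) (l : R) :
  (forall k, k.+2%:R * b k.+1 <= k.+1%:R * b k + eps k) ->
  (forall eta, 0 < eta -> \forall k \near \oo, eps k <= l + eta) ->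
  forall eta, 0 < eta -> \forall k \near \oo, b k <= l + eta.
Proof.
move=> hb heps eta eta0.
have eta2 : 0 < eta / 2 by rewrite divr_gt0.
have [N _ hN] := heps _ eta2.
pose L := l + eta / 2; pose A := N.+1%:R * (b N - L).
have hA k : (N <= k)%N -> k.+1%:R * (b k - L) <= A.
  elim: k => [|k IH]; first by rewrite leqn0 => /eqP <-.
  rewrite leq_eqVlt => /predU1P[<- //|Nk].
  apply: le_trans (IH Nk).
  have := hb k; have := hN _ Nk; rewrite /= -/L -(@natr1 R k.+1).
  by lra.
have hc : `|A| * k.+1%:R^-1 @[k --> \oo] --> (0 : R).
  by rewrite -(mulr0 `|A|); apply: cvgM; [exact: cvg_cst|exact: cvg_harmonic].
have /cvgrPdist_le/(_ _ eta2) [N' _ hN'] := hc.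
exists (maxn N N') => // k /=; rewrite geq_max => /andP[Nk N'k].
have := hN' _ N'k; rewrite /= sub0r normrN ger0_norm ?mulr_ge0 // => h1.
have h2 : b k - L <= `|A| * k.+1%:R^-1.
  rewrite ler_pdivlMr // mulrC; apply: le_trans (hA _ Nk) _; exact: ler_norm.
by have := le_trans h2 h1; rewrite /L; lra.
Qed.

End Cesaro.

(** * Demiclosedness under weak limits *)

Section WeakLimits.
Context {R : realType} {U : hilbertType R}.

Lemma inner_cvg0 (I : Type) (F : set_system I) (FF : Filter F)
    (x y : I -> U) (K : R) :
  x i @[i --> F] --> (0 : U) -> (forall i, `|y i| <= K) ->
  inner (x i) (y i) @[i --> F] --> (0 : R).
Proof.
move=> hx hy.
have h : `|x i| * K @[i --> F] --> (0 : R).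
  rewrite -(mul0r K); apply: cvgM; last exact: cvg_cst.
  by rewrite -(normr0 U); exact: cvg_norm.
apply/cvgrPdist_le => e e0; move/cvgrPdist_le: h => /(_ _ e0).
apply: filterS => i; rewrite !sub0r !normrN => h.
apply: le_trans (CauchySchwarz_inner _ _) _.
by apply: le_trans (le_trans (ler_norm _) h); rewrite ler_wpM2l.
Qed.

(** In the cocoercivity inequality between [x i] and [q], strong convergence of [S (x i)] to [0] and
    boundedness of [x i] leave [|S q|^2 / 2 <= 0] in the limit. *)
Lemma demiclosed (S : U -> U) (F : set_system nat) (FF : ProperFilter F)
    (x : nat -> U) (q : U) (K : R) :
  (forall x y, 2^-1 * `|S x - S y| ^+ 2 <= inner (S x - S y) (x - y)) ->
  S (x i) @[i --> F] --> (0 : U) -> (forall i, `|x i| <= K) ->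
  (forall v, inner (x i) v @[i --> F] --> inner q v) -> S q = 0.
Proof.
move=> coco hS hx hq.
have l1 : 2^-1 * inner (S (x i) - S q) (S (x i) - S q) @[i --> F]
    --> 2^-1 * inner (0 - S q) (0 - S q).
  apply: cvgM; first exact: cvg_cst.
  by apply: inner_cvg; apply: cvgB => //; exact: cvg_cst.
have l2 : inner (S (x i)) (x i - q) - inner (x i - q) (S q) @[i --> F]
    --> 0 - (inner q (S q) - inner q (S q)).
  apply: cvgB.
    apply: (@inner_cvg0 _ _ _ _ _ (K + `|q|)) => // i.
    by apply: le_trans (ler_normB _ _) _; rewrite lerD2r.
  by under eq_fun do rewrite innerDl innerNl; apply: cvgB => //; exact: cvg_cst.
have : 2^-1 * inner (0 - S q) (0 - S q) <= 0 - (inner q (S q) - inner q (S q)).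
  apply: (@ler_cvg_to _ F _ R _ _ _ _ l1 l2); apply: filterE => i.
  rewrite -(innerC (S q)) -innerNl -innerDl -sqr_norm_inner; exact: coco.
rewrite !sub0r innerNl innerNr opprK subrr oppr0 => h.
by apply: inner_le0_eq0; lra.
Qed.

End WeakLimits.

(* [S = I - G] for a nonexpansive [G], [uh k.+1 = G (u k)]; [z] is the moving
   anchor of the scheme, constant when [a = 1]. *)
Section AnchoredIteration.
Context {R : realType} {U : hilbertType R}.
Variables (S : U -> U) (u uh z : nat -> U) (a c : R).
Hypothesis S_coco : forall x y,
  2^-1 * `|S x - S y| ^+ 2 <= inner (S x - S y) (x - y).
Hypotheses (a1 : 1 <= a) (ac : 2 * a * c = a - 1).
Hypothesis uE : forall k, (k%:R + a) *: u k = a *: z k + k%:R *: uh k.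
Hypothesis uhE : forall k, uh k.+1 = u k - S (u k).
Hypothesis zE : forall k, z k.+1 = z k - c *: S (u k).

Let a0 : 0 < a. Proof. by apply: lt_le_trans a1. Qed.

Let S_fix x p : S p = 0 -> 2^-1 * inner (S x) (S x) <= inner (S x) (x - p).
Proof. by move=> p0; have := S_coco x p; rewrite p0 subr0 sqr_norm_inner. Qed.

Definition energy p k : R :=
  a * (k%:R + a) * inner (S (u k)) (u k - z k)
  + k%:R * (k%:R + a) / 2 * inner (S (u k)) (S (u k))
  + a ^+ 2 * inner (z k - p) (z k - p).

(** Cocoercivity between [u k] and [u k.+1], with weight [n (n + a)], is added to the fixed-point
    inequality, with weight [a (a - 1)]. The latter offsets the cross term of [|z k.+1 - p|^2] and
    the coefficient mismatch [a (k + a) - a n]. *)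
Lemma energy_step p k : S p = 0 ->
  energy p k.+1 <= energy p k
    - (a - 1) / 2 * (k%:R + (a + 1) / 2) * inner (S (u k)) (S (u k)).
Proof.
move=> p0.
set n : R := k%:R + 1.
have k0 : (0 : R) <= k%:R by [].
have n0 : 0 <= n by rewrite /n; lra.
have stepE : (n + a) *: u k.+1 = a *: z k.+1 + n *: (u k - S (u k)).
  by rewrite -uhE /n natr1 uE.
(* The displacement is written with the new gap here and with the old one in [hB]; pairing with
   [S (u k.+1)] and [S (u k)] respectively produces the first terms of the two energies. *)
have hA v : n * inner v (u k.+1 - u k)
    = - n * inner v (S (u k)) - a * inner v (u k.+1 - z k.+1).
  have := congr1 (inner v) stepE; rewrite !innerE; lra.
have hB v : (n + a) * inner v (u k.+1 - u k)
    = - n * inner v (S (u k)) + a * inner v (z k - u k)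
      - a * c * inner v (S (u k)).
  have := congr1 (inner v) stepE; rewrite zE !innerE; lra.
have hz : a ^+ 2 * inner (z k.+1 - p) (z k.+1 - p)
    = a ^+ 2 * inner (z k - p) (z k - p)
      - a * (a - 1) * inner (S (u k)) (z k - p)
      + (a - 1) ^+ 2 / 4 * inner (S (u k)) (S (u k)).
  rewrite -ac zE addrAC; move: (z k - p) (S (u k)) => d e.
  by rewrite !innerE (innerC e d); field.
have hfix : 0 <= a * (a - 1) *
    (inner (S (u k)) (u k - p) - 2^-1 * inner (S (u k)) (S (u k))).
  by rewrite mulr_ge0 ?subr_ge0 ?S_fix // mulr_ge0 ?subr_ge0 // ltW.
have hcoco : 0 <= n * (n + a) * (inner (S (u k.+1) - S (u k)) (u k.+1 - u k)
    - 2^-1 * `|S (u k.+1) - S (u k)| ^+ 2).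
  by rewrite mulr_ge0 ?subr_ge0 // mulr_ge0 ?addr_ge0 ?(ltW a0).
have hA1 := congr1 ( *%R (n + a)) (hA (S (u k.+1))).
have hB1 := congr1 ( *%R n) (hB (S (u k))).
have acq : a * c = (a - 1) / 2 by have := ac; lra.
rewrite acq in hB1.
rewrite /energy hz -natr1 -/n.
move: hcoco hA1 hB1 hfix; rewrite /= sqr_norm_inner.
rewrite !innerE (innerC (S (u k)) (S (u k.+1))) /n.
by move: (k%:R : R) => m; lra.
Qed.

(** Once [<S (u k), u k - p> >= |S (u k)|^2 / 2] is used, the excess over the bound is half the
    square of [(k + a) S (u k) - a (z k - p)]. *)
Lemma energy_ge_anchor p k : S p = 0 ->
  a ^+ 2 / 2 * `|z k - p| ^+ 2 <= energy p k.
Proof.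
move=> p0; have k0 : (0 : R) <= k%:R by [].
have h1 := inner_ge0 ((k%:R + a) *: S (u k) - a *: (z k - p)).
have h2 : 0 <= a * (k%:R + a) *
    (inner (S (u k)) (u k - p) - 2^-1 * inner (S (u k)) (S (u k))).
  by rewrite mulr_ge0 ?subr_ge0 ?S_fix // mulr_ge0 ?addr_ge0 // ltW.
move: h1 h2; have -> : u k - p = (u k - z k) + (z k - p) by rewrite addrA subrK.
rewrite /energy sqr_norm_inner; move: (z k - p) (u k - z k) (S (u k)) => d e f.
rewrite !innerE (innerC d f).
by move: (k%:R : R) => m; lra.
Qed.

(** Here the excess is a quarter of the square of [(k + a) S (u k) - 2 a (z k - p)]. *)
Lemma energy_ge_residual p k : S p = 0 ->
  (k%:R + a) ^+ 2 / 4 * `|S (u k)| ^+ 2 <= energy p k.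
Proof.
move=> p0; have k0 : (0 : R) <= k%:R by [].
have h1 := inner_ge0 ((k%:R + a) *: S (u k) - (2 * a) *: (z k - p)).
have h2 : 0 <= a * (k%:R + a) *
    (inner (S (u k)) (u k - p) - 2^-1 * inner (S (u k)) (S (u k))).
  by rewrite mulr_ge0 ?subr_ge0 ?S_fix // mulr_ge0 ?addr_ge0 // ltW.
move: h1 h2; have -> : u k - p = (u k - z k) + (z k - p) by rewrite addrA subrK.
rewrite /energy sqr_norm_inner; move: (z k - p) (u k - z k) (S (u k)) => d e f.
rewrite !innerE (innerC d f).
by move: (k%:R : R) => m; lra.
Qed.

Lemma energy_nonincreasing p : S p = 0 ->
  forall m n, (m <= n)%N -> energy p n <= energy p m.
Proof.
move=> p0 m n; elim: n => [|n IH]; first by rewrite leqn0 => /eqP ->.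
rewrite leq_eqVlt => /predU1P[-> //|/IH]; apply: le_trans.
apply: le_trans (energy_step n p0) _; rewrite gerBl !mulr_ge0 //.
- by rewrite subr_ge0.
- by rewrite addr_ge0 // mulr_ge0 // addr_ge0 // ltW.
- exact: inner_ge0.
Qed.

Lemma anchor0 : z 0%N = u 0%N.
Proof.
have := uE 0%N; rewrite add0r scale0r addr0.
by move=> /(scalerI (lt0r_neq0 a0)).
Qed.

Lemma energy0 p : energy p 0 = (a * `|u 0%N - p|) ^+ 2.
Proof.
by rewrite /energy anchor0 subrr inner0r exprMn sqr_norm_inner; field.
Qed.

Lemma anchor_bounded p k : S p = 0 -> `|z k - p| <= 2 * `|u 0%N - p|.
Proof.
move=> p0; have := energy_ge_anchor k p0.
have := energy_nonincreasing p0 (leq0n k); rewrite energy0 => h1 h2.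
rewrite -(@ler_pXn2r _ 2) ?nnegrE ?mulr_ge0 // exprMn.
have a2 : 0 < a ^+ 2 by rewrite exprn_gt0.
rewrite -(ler_pM2l a2); have := sqr_ge0 (a * `|u 0%N - p|).
by have := le_trans h2 h1; lra.
Qed.

Lemma residual_rate p k : S p = 0 ->
  (k%:R + a) * `|S (u k)| <= 2 * a * `|u 0%N - p|.
Proof.
move=> p0; have := energy_ge_residual k p0.
have := energy_nonincreasing p0 (leq0n k); rewrite energy0 => h1 h2.
have ka : 0 <= k%:R + a by rewrite addr_ge0 // ltW.
rewrite -(@ler_pXn2r _ 2) ?nnegrE ?mulr_ge0 // ?(ltW a0) //.
by have := le_trans h2 h1; lra.
Qed.

(** The gap obeys [(k + 1 + a) (u k.+1 - z k.+1) = (k + 1) ((u k - z k) - (1 - c) S (u k))], with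
    [0 <= c <= 1] and [a >= 1]. *)
Lemma gap_step k : k.+2%:R * `|u k.+1 - z k.+1|
  <= k.+1%:R * (`|u k - z k| + `|S (u k)|).
Proof.
have n0 : (0 : R) <= k.+1%:R by [].
have c0 : 0 <= c.
  by rewrite -(pmulr_rge0 _ (_ : 0 < 2 * a)) ?ac ?subr_ge0 // mulr_gt0.
have c1 : c <= 1.
  by rewrite -(ler_pM2l (_ : 0 < 2 * a)) ?ac ?mulr_gt0 //; have := a0; lra.
have e : (k.+1%:R + a) *: (u k.+1 - z k.+1)
    = k.+1%:R *: ((u k - z k) - (1 - c) *: S (u k)).
  apply: inner_inj => v; have := congr1 (inner v) (uE k.+1).
  by rewrite uhE zE !innerE; move: (k.+1%:R : R) ac => n; lra.
have h1 : (k.+1%:R + a) * `|u k.+1 - z k.+1|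
    <= k.+1%:R * (`|u k - z k| + `|S (u k)|).
  have -> : (k.+1%:R + a) * `|u k.+1 - z k.+1|
      = `|(k.+1%:R + a) *: (u k.+1 - z k.+1)|.
    by rewrite normrZ ger0_norm // addr_ge0 // ltW.
  rewrite e normrZ ger0_norm // ler_wpM2l //.
  apply: le_trans (ler_normB _ _) _.
  by rewrite lerD2l normrZ ger0_norm ?subr_ge0 // ler_piMl // gerBl.
apply: le_trans h1; rewrite ler_wpM2r // -natr1 lerD2l //.
Qed.

(** By induction [(n + 1) |u n - z n| <= n B]: each step adds at most [(n + 1) |S (u n)|], which the
    residual rate bounds by [B]. *)
Lemma gap_bounded p k : S p = 0 -> `|u k - z k| <= 2 * a * `|u 0%N - p|.
Proof.
move=> p0; set B := 2 * a * _.
have B0 : 0 <= B by rewrite /B !mulr_ge0 // ltW.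
have h n : n.+1%:R * `|u n - z n| <= n%:R * B.
  elim: n => [|n IH]; first by rewrite anchor0 subrr normr0 mulr0 mul0r.
  apply: le_trans (gap_step n) _.
  rewrite mulrDr -[X in _ <= X * _]natr1 mulrDl mul1r.
  apply: lerD => //; apply: le_trans (residual_rate n p0).
  by rewrite ler_wpM2r // -natr1 lerD2l.
rewrite -(@ler_pM2l _ k.+1%:R) //; apply: le_trans (h k) _.
by rewrite ler_wpM2r // ler_nat.
Qed.

Lemma iterates_bounded p : S p = 0 -> exists K, forall k, `|u k| <= K.
Proof.
move=> p0; exists (2 * a * `|u 0%N - p| + (2 * `|u 0%N - p| + `|p|)) => k.
have -> : u k = (u k - z k) + ((z k - p) + p) by rewrite subrK subrK.
apply: le_trans (ler_normD _ _) _; apply: lerD; first exact: gap_bounded.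
by apply: le_trans (ler_normD _ _) _; rewrite lerD2r anchor_bounded.
Qed.

Lemma residual_cvg0 p : S p = 0 -> S (u k) @[k --> \oo] --> (0 : U).
Proof.
move=> p0; pose B := 2 * a * `|u 0%N - p|.
have hB : B * k.+1%:R^-1 @[k --> \oo] --> (0 : R).
  by rewrite -(mulr0 B); apply: cvgM; [exact: cvg_cst|exact: cvg_harmonic].
apply/cvgrPdist_le => e e0; move/cvgrPdist_le: hB => /(_ _ e0).
apply: filterS => k; rewrite !sub0r !normrN => h.
apply: le_trans (le_trans (ler_norm _) h).
rewrite ler_pdivlMr // mulrC; apply: le_trans (residual_rate k p0).
by rewrite ler_wpM2r // -natr1 lerD2l.
Qed.

Lemma energy_cvg p : S p = 0 -> exists l : R, energy p k @[k --> \oo] --> l.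
Proof.
move=> p0; exists (limn (energy p)).
apply: nonincreasing_is_cvgn; first by move=> m n; exact: energy_nonincreasing.
exists 0 => _ [n _ <-]; apply: le_trans (energy_ge_anchor n p0).
by rewrite mulr_ge0 ?sqr_ge0 // divr_ge0 ?sqr_ge0.
Qed.

(* The dissipation in [energy_step] gives [sum_k (k + 1) |S (u k)|^2 < oo];
   the gap is at most a Cesaro mean of [(k + 1) |S (u k)|]. *)
Lemma gap_cvg0 p : 1 < a -> S p = 0 -> u k - z k @[k --> \oo] --> (0 : U).
Proof.
move=> a1' p0; have [l hl] := energy_cvg p0.
(* Scaled so that one decrement of [t] dominates [(k + 1) |S (u k)|^2]. *)
pose t k := 2 / (a - 1) * energy p k.
have tc : t k @[k --> \oo] --> 2 / (a - 1) * l.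
  by apply: cvgM => //; exact: cvg_cst.
have st k : k.+1%:R * `|S (u k)| ^+ 2 <= t k - t k.+1.
  have d0 : 0 < a - 1 by rewrite subr_gt0.
  rewrite /t -mulrBr -(ler_pM2l d0).
  have -> : (a - 1) * (2 / (a - 1) * (energy p k - energy p k.+1))
    = 2 * (energy p k - energy p k.+1) by field; rewrite gt_eqF.
  have h1 := energy_step k p0; rewrite -natr1.
  have h2 : 0 <= (a - 1) * (a - 1) * inner (S (u k)) (S (u k)).
    by rewrite !mulr_ge0 ?inner_ge0 // ltW.
  by move: h1 h2; rewrite sqr_norm_inner; move: (k%:R : R) => m; lra.
(* Adding [t k] to the squared gap absorbs the summable error: the limsup of the sum is at most the
   limit of [t], so the gap vanishes. *)
have main : forall eta, 0 < eta -> \forall k \near \oo,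
    `|u k - z k| ^+ 2 + t k <= 2 / (a - 1) * l + eta.
  apply: (@cesaro_limsup_le _ _ (fun k => t k.+1)) => [k|eta eta0].
    have g := gap_step k.
    have n0 : (0 : R) < k.+1%:R by [].
    have m0 : (0 : R) < k.+2%:R by [].
    have st1 := st k.
    have am := sqr_ge0 (`|u k - z k| - k.+1%:R * `|S (u k)|).
    have n1 : (k.+2%:R : R) = k.+1%:R + 1 by rewrite natr1.
    have sq : k.+2%:R * (k.+2%:R * `|u k.+1 - z k.+1| ^+ 2) <=
        k.+2%:R * (k.+1%:R * `|u k - z k| ^+ 2
           + k.+1%:R * (k.+1%:R * `|S (u k)| ^+ 2)).
      apply: (@le_trans _ _ ((k.+1%:R * (`|u k - z k| + `|S (u k)|)) ^+ 2)).
        rewrite mulrA -expr2 -exprMn ler_pXn2r ?nnegrE //.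
      have am1 : 0 <= k.+1%:R * (`|u k - z k| - k.+1%:R * `|S (u k)|) ^+ 2.
        by rewrite mulr_ge0 // ltW.
      rewrite n1; move: am1; move: (k.+1%:R : R) => n; lra.
    rewrite (ler_pM2l m0) in sq.
    have st2 : k.+1%:R * (k.+1%:R * `|S (u k)| ^+ 2)
        <= k.+1%:R * (t k - t k.+1).
      by rewrite (ler_pM2l n0).
    move: sq st2; rewrite n1; move: (k.+1%:R : R) => n; lra.
  have tc' : t k.+1 @[k --> \oo] --> 2 / (a - 1) * l by rewrite cvg_shiftS.
  move/cvgrPdist_le: tc' => /(_ _ eta0); apply: filterS => k.
  by rewrite distrC ler_norml => /andP[_ h]; lra.
apply/cvgrPdist_le => e e0.
have e2 : 0 < e ^+ 2 / 2 by rewrite divr_gt0 ?exprn_gt0.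
move/cvgrPdist_le: tc => /(_ _ e2); have := main _ e2.
apply: filterS2 => k h1; rewrite ler_norml => /andP[h2 h3].
rewrite sub0r normrN -(@ler_pXn2r _ 2) ?nnegrE ?(ltW e0) //; lra.
Qed.

(* With [a = 1] the anchor is fixed and the scheme is Halpern's iteration. *)
Lemma halpern_cvg p : a = 1 -> S p = 0 ->
  (forall q, S q = 0 -> inner (u 0%N - p) (q - p) <= 0) ->
  u k @[k --> \oo] --> p.
Proof.
move=> a1' p0 hp.
have c0 : c = 0 by move: ac; rewrite a1'; lra.
have zu k : z k = u 0%N.
  elim: k => [|k IH]; first exact: anchor0.
  by rewrite zE c0 scale0r subr0.
have [K hK] := iterates_bounded p0.
have Sc := residual_cvg0 p0.
(* Each weak ultralimit of [u] is a zero of [S] by demiclosedness, so the assumption on [p] applies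
   to it. *)
have lims eta : 0 < eta ->
    \forall k \near \oo, 2 * inner (u 0%N - p) (u k - p) <= 0 + eta.
  move=> eta0; rewrite add0r; apply: filter_ultra => G UG FG.
  have [q hq] := weak_ultralimit UG hK.
  have Sq : S q = 0.
    by apply: (demiclosed _ S_coco _ hK hq) => A /Sc; exact: FG.
  have hl : 2 * inner (u k - p) (u 0%N - p) @[k --> G]
      --> 2 * inner (q - p) (u 0%N - p).
    apply: cvgM; first exact: cvg_cst.
    under eq_fun do rewrite innerDl.
    by rewrite innerDl; apply: cvgD => //; exact: cvg_cst.
  move/cvgrPdist_le: hl => /(_ _ eta0); apply: filterS => k.
  rewrite distrC ler_norml => /andP[_ h].
  have := hp _ Sq; rewrite innerC => h2; rewrite innerC; lra.
have main : forall eta, 0 < eta ->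
    \forall k \near \oo, `|u k - p| ^+ 2 <= 0 + eta.
  (* With [G = I - S], pair [(k + 2) (u k.+1 - p) = (u 0 - p) + (k + 1) (G (u k) - p)] with
     [u k.+1 - p] and use [|G (u k) - p| <= |u k - p|]. *)
  apply: (@cesaro_limsup_le _ _ (fun k => 2 * inner (u 0%N - p) (u k.+1 - p))).
    move=> k; have e : k.+2%:R *: (u k.+1 - p)
        = (u 0%N - p) + k.+1%:R *: ((u k - p) - S (u k)).
      apply: inner_inj => v; have := congr1 (inner v) (uE k.+1).
      rewrite uhE zu a1' -(@natr1 R k.+1) !innerE.
      by move: (k.+1%:R : R) => n; lra.
    have n0 : (0 : R) <= k.+1%:R by [].
    have := congr1 (inner (u k.+1 - p)) e.
    have : 0 <= k.+1%:R * inner ((u k - p) - S (u k) - (u k.+1 - p))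
        ((u k - p) - S (u k) - (u k.+1 - p)).
      by rewrite mulr_ge0 // inner_ge0.
    have : 0 <= k.+1%:R * (inner (S (u k)) (u k - p)
        - 2^-1 * inner (S (u k)) (S (u k))).
      by rewrite mulr_ge0 ?subr_ge0 // S_fix.
    have := inner_ge0 (u k.+1 - p).
    rewrite -(@natr1 R k.+1) !sqr_norm_inner.
    move: (u k.+1 - p) (u k - p) (S (u k)) (u 0%N - p) => x y w b.
    rewrite !innerE (innerC y x) (innerC w x) (innerC w y) (innerC b x).
    by move: (k.+1%:R : R) => n; lra.
  move=> eta /lims [N _ hN]; exists N => // k /= Nk; apply: hN => /=.
  exact: leqW.
apply/cvgrPdist_le => e e0.
have e2 : 0 < e ^+ 2 by rewrite exprn_gt0.
have := main _ e2; apply: filterS => k; rewrite add0r => h.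
by rewrite distrC -(@ler_pXn2r _ 2) ?nnegrE ?(ltW e0).
Qed.

(** Weak ultralimits are zeros of [S] by demiclosedness. Two of them, [q] and [q'], coincide because
    [energy q - energy q'] has a single limit, which is affine in the ultralimit. *)
Lemma fast_KM_weak_cvg p : 1 < a -> S p = 0 ->
  exists q, S q = 0 /\ forall v, inner (u k) v @[k --> \oo] --> inner q v.
Proof.
move=> a1' p0.
have [K hK] := iterates_bounded p0.
have gap0 := gap_cvg0 a1' p0.
have ultra G : UltraFilter G -> \oo `<=` G -> exists q, S q = 0 /\
    forall v, inner (u k) v @[k --> G] --> inner q v.
  move=> UG FG; have [q hq] := weak_ultralimit UG hK.
  exists q; split => //; apply: (demiclosed _ S_coco _ hK hq) => A.
  by move=> /(residual_cvg0 p0); exact: FG.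
have [G0 [UG0 FG0]] := ultraFilterLemma eventually_filter.
have [q [Sq hq]] := ultra G0 UG0 FG0.
exists q; split => // v; apply: cvg_ultra => G UG FG.
have [q' [Sq' hq']] := ultra G UG FG.
suff -> : q = q' by exact: hq'.
have [l hl] := energy_cvg Sq; have [l' hl'] := energy_cvg Sq'.
have anchor (F : set_system nat) y : Filter F -> \oo `<=` F ->
    (forall w, inner (u k) w @[k --> F] --> inner y w) ->
    energy q k - energy q' k @[k --> F] --> a ^+ 2 *
      (2 * inner y (q' - q) + inner q q - inner q' q').
  move=> FF FoF hy.
  have -> : (fun k => energy q k - energy q' k) = (fun k => a ^+ 2 *
      (2 * (inner (u k) (q' - q) - inner (u k - z k) (q' - q))
       + inner q q - inner q' q')).
    apply/funext => k; rewrite /energy.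
    by rewrite !innerE (innerC q (z k)) (innerC q' (z k)); lra.
  apply: cvgM; first exact: cvg_cst.
  apply: cvgB; last exact: cvg_cst.
  apply: cvgD; last exact: cvg_cst.
  apply: cvgM; first exact: cvg_cst.
  rewrite -[X in _ --> X]subr0; apply: cvgB => //.
  rewrite -(inner0l (q' - q)); apply: inner_cvgl => A /gap0; exact: FoF.
have lim : energy q k - energy q' k @[k --> \oo] --> l - l' by exact: cvgB.
have lim0 : energy q k - energy q' k @[k --> G0] --> l - l'.
  by move=> A /lim; exact: FG0.
have lim1 : energy q k - energy q' k @[k --> G] --> l - l'.
  by move=> A /lim; exact: FG.
have h0 : l - l' = a ^+ 2 *
    (2 * inner q (q' - q) + inner q q - inner q' q') :> R.
  by apply: (cvg_unique (@Rhausdorff R) lim0); exact: anchor.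
have h1 : l - l' = a ^+ 2 *
    (2 * inner q' (q' - q) + inner q q - inner q' q') :> R.
  by apply: (cvg_unique (@Rhausdorff R) lim1); exact: anchor.
have a2 : 0 < a ^+ 2 by rewrite exprn_gt0.
have : a ^+ 2 * inner (q - q') (q - q') = 0.
  by move: h0 h1; rewrite !innerE (innerC q' q); lra.
move/eqP; rewrite mulf_eq0 gt_eqF //= => /eqP h.
by apply/eqP; rewrite -subr_eq0; apply/eqP/inner_le0_eq0; rewrite h.
Qed.

End AnchoredIteration.
(** * Reduction of the degenerate method to the space U *)

Section Recursion.
Context {R : realType}.

(** Once [d k <= (1 - q) eta / 2], the excess [e k - eta / 2] is at most multiplied by [q] at each
    step. *)
Lemma contraction_cvg0 (e d : nat -> R) (q : R) :
  0 <= q < 1 -> (forall k, 0 <= e k) ->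
  (forall k, e k.+1 <= q * e k + d k) -> d k @[k --> \oo] --> (0 : R) ->
  e k @[k --> \oo] --> (0 : R).
Proof.
move=> /andP[q0 q1] e0 he hd; apply/cvgrPdist_le => eta eta0.
have q1' : 0 < 1 - q by rewrite subr_gt0.
have eta1 : 0 < (1 - q) * (eta / 2) by rewrite mulr_gt0 // divr_gt0.
move/cvgrPdist_le: hd => /(_ _ eta1) [N _ hN].
pose A := `|e N - eta / 2|.
have hA j : e (N + j)%N - eta / 2 <= q ^+ j * A.
  elim: j => [|j IH]; first by rewrite addn0 expr0 mul1r ler_norm.
  rewrite addnS exprS -mulrA.
  apply: (@le_trans _ _ (q * (e (N + j)%N - eta / 2))); last exact: ler_wpM2l.
  have := hN (N + j)%N (leq_addr _ _); rewrite /= sub0r normrN ler_norml.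
  by move=> /andP[_ h]; have := he (N + j)%N; lra.
have qc : q ^+ j * A @[j --> \oo] --> (0 : R).
  rewrite -(mul0r A); apply: cvgM; last exact: cvg_cst.
  by apply: cvg_expr; rewrite ger0_norm.
have eta2 : 0 < eta / 2 by rewrite divr_gt0.
move/cvgrPdist_le: qc => /(_ _ eta2) [N' _ hN'].
exists (N + N')%N => // k /= hk.
rewrite sub0r normrN ger0_norm //.
have Nk : (N <= k)%N := leq_trans (leq_addr _ _) hk.
have kE : k = (N + (k - N))%N by rewrite subnKC.
have := hN' (k - N)%N; rewrite /= leq_subRL //.
move=> /(_ hk); rewrite sub0r normrN ler_norml => /andP[_ h].
by have := hA (k - N)%N; rewrite -kE; lra.
Qed.

(** Used in [H], before [Cstar] is applied: for [alpha = 2] its constancy yields the recursion of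
    [w] itself, not only of its image in [U]. *)
Definition anchor {V : lmodType R} (a : R) (w what : nat -> V) k : V :=
  a^-1 *: ((k%:R + a) *: w k - k%:R *: what k).

Lemma anchorE (V : lmodType R) (a : R) (w what : nat -> V) k : 0 < a ->
  (k%:R + a) *: w k = a *: anchor a w what k + k%:R *: what k.
Proof. by move=> a0; rewrite scalerA divff ?gt_eqF // scale1r subrK. Qed.

(** As [k + alpha = (k + 1) + (alpha - 1)], the weight of [w k.+1] cancels the denominators of the
    scheme. *)
Lemma anchor_step (H : hilbertType R) (alpha : R) (w what : nat -> H) k :
  1 < alpha ->
  w k.+1 = w k + (alpha / (2 * (k%:R + alpha))) *: (what k.+1 - w k)
         + (k%:R / (k%:R + alpha)) *: (what k.+1 - what k) ->
  anchor (alpha - 1) w what k.+1 = anchor (alpha - 1) w what k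
    - ((alpha - 2) / (2 * (alpha - 1))) *: (w k - what k.+1).
Proof.
move=> a1 wS; rewrite /anchor wS -natr1.
have k0 : (0 : R) <= k%:R by [].
apply: inner_inj => v; rewrite !innerE.
by move: (k%:R : R) k0 => n n0; field; rewrite !gt_eqF //; lra.
Qed.

End Recursion.

(** * The reduced resolvent on [U] and its fixed points *)

Section Main.
Context {R : realType} {H U : hilbertType R}.
Variables (T : H -> set H) (M : {linear H -> H}).
Variables (C : {linear U -> H}) (Cstar : H -> U).
Variable f : H -> H.
Hypotheses (maxT : maximal_monotone T) (admM : admissible_preconditioner M T).
Hypotheses (clM : closed (range M)) (Cbd : bounded_operator C).
Hypotheses (injC : injective C) (adjC : is_adjoint C Cstar).
Hypothesis MC : forall x, M x = C (Cstar x).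
Hypothesis fP : forall z, sv_dom (sum_inv M T) z -> sum_inv M T z = [set f z].
Hypothesis fc : {within sv_dom (sum_inv M T), continuous f}.

Let Mpsd : positive_semidefinite M. Proof. by case: admM. Qed.

Let J (u : U) : U := Cstar (f (C u)).

Lemma mem_precond_resolvent w x : precond_resolvent M T w x <-> T x (M w - M x).
Proof.
split; first by move=> [y -> /mem_sum_inv].
by move=> h; exists (M w) => //; apply/mem_sum_inv.
Qed.

(** Since [Cstar] is onto, [C u] is some [M x], and the preconditioned resolvent has full domain. *)
Lemma dom_C u : sv_dom (sum_inv M T) (C u).
Proof.
have [_ _ _ _ dom] := admM; have [x <-] := adjoint_onto adjC injC MC clM u.
have : [set: H] x by []; rewrite -dom => -[y /mem_precond_resolvent h].
by exists y; apply/mem_sum_inv; rewrite -MC.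
Qed.

Lemma reduced_graph u : T (f (C u)) (C (u - J u)).
Proof. by rewrite linearB /= -MC; exact: (sum_inv_fun fP (dom_C u)). Qed.

(** Monotonicity of [T] at two points given by [reduced_graph], with [C] moved across the inner
    product. *)
Lemma reduced_firm u v :
  inner (J u - J v) (J u - J v) <= inner (J u - J v) (u - v).
Proof.
have [monT _] := maxT.
have := monT _ _ _ _ (reduced_graph u) (reduced_graph v).
rewrite -linearB -(inner_adjoint adjC) (adjointB adjC) -/(J u) -/(J v).
move: (J u) (J v) => x y.
by rewrite !innerE; lra.
Qed.

Lemma sum_inv_zero x : T x 0 -> f (C (Cstar x)) = x.
Proof. by move=> Tx; apply: (sum_inv_eq fP); rewrite MC subrr. Qed.

Lemma zeros_image u : (Cstar @` zeros T) u <-> J u = u.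
Proof.
split; first by move=> [x Tx <-]; rewrite /J sum_inv_zero.
move=> Ju; exists (f (C u)) => //.
by have := reduced_graph u; rewrite Ju subrr linear0.
Qed.

Lemma zero_precond_fix x : T x 0 -> sv_fix (precond_resolvent M T) x.
Proof. by move=> Tx; apply/mem_precond_resolvent; rewrite subrr. Qed.

Variable rho : R.
Hypothesis rho02 : 0 < rho <= 2.

Let S (u : U) : U := rho *: (u - J u).

(** Firm nonexpansiveness of [J] leaves the slack [rho (1 - rho / 2) |(u - v) - (J u - J v)|^2],
    nonnegative because [rho <= 2]. *)
Lemma relaxed_coco u v : 2^-1 * `|S u - S v| ^+ 2 <= inner (S u - S v) (u - v).
Proof.
have /andP[r0 r2] := rho02; have h := reduced_firm u v.
have e : S u - S v = rho *: ((u - v) - (J u - J v)).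
  by apply: inner_inj => w; rewrite /S !innerE; ring.
rewrite sqr_norm_inner e; move: h; move: (u - v) (J u - J v) => d j h.
have h1 : 0 <= rho * (2 - rho) * inner (d - j) (d - j).
  by rewrite mulr_ge0 ?inner_ge0 // mulr_ge0 ?subr_ge0 // ltW.
have h2 : 0 <= rho * (inner j d - inner j j).
  by rewrite mulr_ge0 ?subr_ge0 // ltW.
by move: h1 h2; rewrite !innerE (innerC d j); lra.
Qed.

Lemma relaxed_eq0 u : S u = 0 <-> (Cstar @` zeros T) u.
Proof.
have /andP[r0 _] := rho02; rewrite zeros_image /S; split.
  by move/eqP; rewrite scaler_eq0 gt_eqF //= subr_eq0 eq_sym => /eqP.
by move=> ->; rewrite subrr scaler0.
Qed.

(** With weights [1 - t] and [t], the vectors [w - x] and [w - y] cancel in the sum of the two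
    cocoercivity inequalities, which leaves [|S w|^2 / 2 <= 0]. *)
Lemma zeros_image_convex x y (t : R) :
  (Cstar @` zeros T) x -> (Cstar @` zeros T) y -> 0 <= t <= 1 ->
  (Cstar @` zeros T) ((1 - t) *: x + t *: y).
Proof.
move=> /relaxed_eq0 Sx /relaxed_eq0 Sy /andP[t0 t1]; apply/relaxed_eq0.
set w := (1 - t) *: x + t *: y.
have h1 : 0 <= (1 - t) * (inner (S w) (w - x) - 2^-1 * inner (S w) (S w)).
  rewrite mulr_ge0 ?subr_ge0 //.
  by have := relaxed_coco w x; rewrite Sx subr0 sqr_norm_inner.
have h2 : 0 <= t * (inner (S w) (w - y) - 2^-1 * inner (S w) (S w)).
  rewrite mulr_ge0 ?subr_ge0 //.
  by have := relaxed_coco w y; rewrite Sy subr0 sqr_norm_inner.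
apply: inner_le0_eq0; move: h1 h2; move: (S w) => s.
by rewrite /w !innerE; lra.
Qed.

Lemma zeros_image_convex_set : convex_set (Cstar @` zeros T).
Proof.
move=> x y l; rewrite !inE => hx hy.
rewrite /conv /= addrC; apply: (zeros_image_convex hy hx).
by apply/andP; split.
Qed.

(** This is the zero set of [S], which cocoercivity makes [2]-Lipschitz. *)
Lemma zeros_image_closed : closed (Cstar @` zeros T).
Proof.
have Slip u v : `|S u - S v| <= 2 * `|u - v|.
  have [->|s0] := eqVneq (S u - S v) 0; first by rewrite normr0 mulr_ge0.
  have sp : 0 < `|S u - S v| by rewrite normr_gt0.
  rewrite -(ler_pM2l sp); have := relaxed_coco u v.
  by have := inner_le_norm (S u - S v) (u - v); rewrite expr2; lra.
have Sc : continuous S.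
  move=> u; apply/cvgrPdist_le => e e0; near=> v.
  apply: le_trans (Slip _ _) _; rewrite mulrC -ler_pdivlMr //.
  by near: v; apply: cvgr_dist_le; [exact: cvg_id|rewrite divr_gt0].
have -> : Cstar @` zeros T = (fun u => `|S u|) @^-1` [set x : R | x <= 0].
  apply/seteqP; split => u /=.
    by move=> /relaxed_eq0 ->; rewrite normr0.
  by rewrite normr_le0 => /eqP /relaxed_eq0.
apply: preimage_closed; last exact: closed_le.
by move=> u _; apply: cvg_norm; exact: Sc.
Unshelve. all: by end_near. Qed.

(** * The sequences of the method and their images in [U] *)

Variables (alpha : R) (w0 : H) (wbar what w : nat -> H).
Hypothesis alpha2 : 2 <= alpha.
Hypothesis dPPM : accelerated_dPPM M T alpha rho w0 wbar what w.

Let u k := Cstar (w k).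
Let uh k := Cstar (what k).
Let a := alpha - 1.
Let c := (alpha - 2) / (2 * (alpha - 1)).
Let z k := Cstar (anchor a w what k).

Let a1 : 1 <= a. Proof. by rewrite /a; have := alpha2; lra. Qed.
Let a0 : 0 < a. Proof. exact: lt_le_trans a1. Qed.

Lemma wbarE k : wbar k = f (C (u k)).
Proof.
have [_ _ hw _ _] := dPPM.
have /mem_precond_resolvent h : precond_resolvent M T (w k) (wbar k).
  by rewrite hw.
by rewrite /u -MC (sum_inv_eq fP h).
Qed.

Lemma what_residual k : Cstar (w k - what k.+1) = S (u k).
Proof.
have [_ _ _ hw _] := dPPM.
rewrite hw /S /J -wbarE /u -(adjointB adjC) -(adjointZ adjC).
by congr (Cstar _); apply: inner_inj => v; rewrite !innerE; ring.
Qed.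

Let ac : 2 * a * c = a - 1.
Proof. by rewrite /c -/a /a; field; rewrite gt_eqF //; have := alpha2; lra. Qed.

Let uE k : (k%:R + a) *: u k = a *: z k + k%:R *: uh k.
Proof. by rewrite /u /z /uh -!(adjointZ adjC) -(adjointD adjC) -anchorE. Qed.

Let uhE k : uh k.+1 = u k - S (u k).
Proof. by rewrite -what_residual /u /uh -(adjointB adjC) opprB addrC subrK. Qed.

Let anchorS k :
  anchor a w what k.+1 = anchor a w what k - c *: (w k - what k.+1).
Proof.
by have [_ _ _ _ hw] := dPPM; apply: anchor_step => //; have := alpha2; lra.
Qed.

Let zE k : z k.+1 = z k - c *: S (u k).
Proof. by rewrite /z anchorS (adjointB adjC) (adjointZ adjC) what_residual. Qed.

(** The points [C (u n)] never leave the domain, so continuity of [f] for the induced topology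
    applies. *)
Lemma wbar_cvg_of p : u n @[n --> \oo] --> p -> wbar n @[n --> \oo] --> f (C p).
Proof.
move=> hu; have := (subspace_continuousP _ _).1 fc _ (dom_C p).
move=> fcp; under eq_fun do rewrite wbarE.
suff : C (u n) @[n --> \oo] --> within (sv_dom (sum_inv M T)) (nbhs (C p)).
  by move=> h; apply: (cvg_comp _ _ h fcp).
have Cu : C (u n) @[n --> \oo] --> C p.
  by apply: continuous_cvg hu; exact: (linear_bounded_continuous C).1.
move=> A hA.
have h : \forall n \near \oo,
  sv_dom (sum_inv M T) (C (u n)) -> A (C (u n)) := Cu _ hA.
suff : \forall n \near \oo, A (C (u n)) by [].
by apply: filterS h => n; apply; exact: dom_C.
Qed.

Lemma wbar_strong_cvg : zeros T !=set0 -> alpha = 2 ->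
  exists p, exists wstar,
    [/\ projection (Cstar @` zeros T) (Cstar w0) = [set p],
        sum_inv M T (C p) = [set wstar],
        zeros T wstar /\ sv_fix (precond_resolvent M T) wstar,
        wbar n @[n --> \oo] --> wstar &
        rho < 2 -> w n @[n --> \oo] --> wstar /\ what n @[n --> \oo] --> wstar].
Proof.
move=> [x0 Tx0] al2; have [hw0 hwh0 _ hwh _] := dPPM.
have ne : (Cstar @` zeros T) !=set0 by exists (Cstar x0), x0.
have cv := zeros_image_convex.
have [p hp] := projection_exists cv (Cstar w0) ne zeros_image_closed.
have [Kp _] := hp.
have Sp : S p = 0 by apply/relaxed_eq0.
have Jp : J p = p by apply/zeros_image.
have up : u n @[n --> \oo] --> p.
  apply: (halpern_cvg relaxed_coco a1 ac uE uhE zE _ Sp).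
    by rewrite /a al2; lra.
  move=> q /relaxed_eq0 Kq; rewrite /u hw0; exact: (projection_inner_le0 cv hp).
have Tws : T (f (C p)) 0.
  by have := reduced_graph p; rewrite Jp subrr linear0.
have wb := wbar_cvg_of up.
exists p, (f (C p)); split => //.
- apply/seteqP; split => q /=; last by move=> ->.
  by move=> hq; exact: (projection_uniq cv hq hp).
- exact/fP/dom_C.
- by split => //; exact: zero_precond_fix.
move=> r2; have /andP[r0 _] := rho02.
set ws := f (C p) in wb *.
have aE : a = 1 by rewrite /a al2; lra.
have cE : c = 0 by rewrite /c al2 subrr mul0r.
have anch k : anchor a w what k = w0.
  elim: k => [|k IH]; last by rewrite anchorS cE scale0r subr0.
  by rewrite /anchor aE invr1 scale0r subr0 add0r !scale1r hw0.
(* As [w k.+1] is the mean of [w0], with weight [1 / (k + 2)], and [what k.+1], the distance to the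
   limit contracts by [|1 - rho| < 1] up to the vanishing error [d]. *)
pose e k := `|w k - ws|.
pose d k := k.+2%:R^-1 * `|w0 - ws| + rho * `|wbar k - ws|.
have ec : e k @[k --> \oo] --> (0 : R).
  apply: (@contraction_cvg0 _ e d `|1 - rho|).
  - by rewrite normr_ge0 /= ltr_norml; apply/andP; split; lra.
  - by move=> k; exact: normr_ge0.
  - move=> k; pose m : R := k.+2%:R^-1.
    have m0 : 0 < m by rewrite invr_gt0.
    have m1 : m <= 1 by rewrite invf_le1 // ler1n.
    have kE : k.+1%:R * m = 1 - m.
      have : k.+2%:R * m = 1 by rewrite /m mulfV ?pnatr_eq0.
      by rewrite -(@natr1 R k.+1) mulrDl mul1r => h; lra.
    have -> : e k.+1 = `|m *: (w0 - ws)
        + (1 - m) *: ((1 - rho) *: (w k - ws) + rho *: (wbar k - ws))|.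
      congr (`| _ |).
      have h := anchorE w what k.+1 a0; rewrite anch aE scale1r natr1 in h.
      have h1 : w k.+1 = m *: w0 + (1 - m) *: what k.+1.
        by rewrite -kE mulrC -scalerA -scalerDr -h scalerA mulVf // scale1r.
      rewrite h1 hwh; apply: inner_inj => v; rewrite !innerE; lra.
    apply: le_trans (ler_normD _ _) _; rewrite /d addrCA.
    rewrite normrZ (gtr0_norm m0) lerD2l normrZ ger0_norm ?subr_ge0 //.
    apply: (@le_trans _ _ `|(1 - rho) *: (w k - ws) + rho *: (wbar k - ws)|).
      by rewrite ler_piMl // gerBl ltW.
    by apply: le_trans (ler_normD _ _) _; rewrite !normrZ (gtr0_norm r0).
  - rewrite -(addr0 0); apply: cvgD.
      rewrite -(mul0r `|w0 - ws|); apply: cvgM; last exact: cvg_cst.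
      by rewrite (cvg_shiftS (fun k => k.+1%:R^-1 : R)); exact: cvg_harmonic.
    rewrite -(mulr0 rho); apply: cvgM; first exact: cvg_cst.
    rewrite -(normr0 H); apply: cvg_norm; rewrite -(subrr ws).
    by apply: cvgB => //; exact: cvg_cst.
have wc : w n @[n --> \oo] --> ws.
  apply/cvgrPdist_le => eta eta0; move/cvgrPdist_le: ec => /(_ _ eta0).
  by apply: filterS => k; rewrite sub0r normrN ger0_norm ?normr_ge0 // distrC.
split => //; rewrite -cvg_shiftS.
have -> : ws = (1 - rho) *: ws + rho *: ws by rewrite -scalerDl subrK scale1r.
rewrite /mkset; under eq_fun do rewrite hwh.
by apply: cvgD; apply: cvgZ => //; exact: cvg_cst.
Qed.

(** Monotonicity of [f] is tested between [C (u k)] and the point [y] at distance [r / 2] from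
    [M x0] in the direction of [wbar k], where [f] is bounded by [K]; this isolates
    [r / 2 |wbar k|]. *)
Lemma wbar_bounded x0 B : T x0 0 -> (forall k, `|u k| <= B) ->
  exists K, forall k, `|wbar k| <= K.
Proof.
move=> Tx0 hB; have [monT _] := maxT.
have [Mbd Msym _ _ _] := admM.
have [r r0 [K hK]] := sum_inv_dom_nbhs maxT Mbd Msym Mpsd fP fc Tx0.
have [d d0 hd] := bounded_operator_le Cbd.
pose v0 := Cstar x0.
pose L := (B + `|v0|) * (B + `|v0|) + `|v0| * (B + `|v0|)
  + K * (d * B + (`|M x0| + r)).
exists (2 / r * L) => k.
have B0 : 0 <= B by apply: le_trans (hB 0%N).
have K0 : 0 <= K.
  have [|_ h] := hK (M x0); first by rewrite subrr normr0.
  exact: le_trans h.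
have uv : `|u k - v0| <= B + `|v0|.
  by apply: le_trans (ler_normB _ _) _; rewrite lerD2r.
have [wb0|wb0] := eqVneq (wbar k) 0.
  rewrite wb0 normr0 mulr_ge0 ?divr_ge0 ?(ltW r0) // /L.
  by rewrite !(addr_ge0, mulr_ge0) // ltW.
have wp : 0 < `|wbar k| by rewrite normr_gt0.
pose y := M x0 + (r / 2 / `|wbar k|) *: wbar k.
have ny : `|y - M x0| = r / 2.
  rewrite /y addrC addKr normrZ ger0_norm ?divr_ge0 ?(ltW r0) //.
  by rewrite divfK // gt_eqF.
have [dy fy] : sv_dom (sum_inv M T) y /\ `|f y| <= K.
  by apply: hK; rewrite ny; lra.
have Ty := sum_inv_fun fP dy.
have Tw := sum_inv_fun fP (dom_C (u k)); rewrite -wbarE in Tw.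
have hmon := monT _ _ _ _ Tw Ty.
have hM := Mpsd (wbar k - f y).
have key : inner (wbar k) (y - M x0)
    <= inner (wbar k) (C (u k - v0)) - inner (f y) (C (u k) - y).
  have -> : C (u k - v0) = C (u k) - M x0 by rewrite MC linearB.
  have e2 : M (wbar k - f y) = M (wbar k) - M (f y) by rewrite linearB.
  move: hmon hM; rewrite e2; clearbody y.
  move: (C (u k)) (M x0) (f y) (wbar k) => A3 A4 b1 b2.
  by rewrite (innerC (_ - _) (b2 - b1)) !innerE; lra.
have e1 : inner (wbar k) (y - M x0) = r / 2 * `|wbar k|.
  rewrite /y addrC addKr innerZr -sqr_norm_inner expr2 mulrA divfK // gt_eqF //.
have h1 : inner (wbar k) (C (u k - v0))
    <= (B + `|v0|) * (B + `|v0|) + `|v0| * (B + `|v0|).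
  rewrite -(inner_adjoint adjC) wbarE -/(J (u k)).
  have Jv : J v0 = v0 by apply/zeros_image; exists x0.
  have firm := reduced_firm (u k) v0; rewrite Jv in firm.
  have lip : `|J (u k) - v0| <= `|u k - v0|.
    have [->|j0] := eqVneq (J (u k) - v0) 0; first by rewrite normr0.
    have jp : 0 < `|J (u k) - v0| by rewrite normr_gt0.
    rewrite -(ler_pM2l jp) -expr2 sqr_norm_inner.
    exact: le_trans firm (inner_le_norm _ _).
  rewrite -[J (u k)](subrK v0) innerDl; apply: lerD.
    apply: le_trans (inner_le_norm _ _) _; apply: ler_pM => //.
    exact: le_trans uv.
  by apply: le_trans (inner_le_norm _ _) _; rewrite ler_wpM2l.
have h2 : - inner (f y) (C (u k) - y) <= K * (d * B + (`|M x0| + r)).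
  rewrite -innerNl; apply: le_trans (inner_le_norm _ _) _.
  rewrite normrN; apply: ler_pM => //; apply: le_trans (ler_normB _ _) _.
  apply: lerD; first by apply: le_trans (hd _) _; rewrite ler_wpM2l.
  rewrite -[y](subrK (M x0)) addrC; apply: le_trans (ler_normD _ _) _.
  by rewrite lerD2l ny; lra.
have fin : r / 2 * `|wbar k| <= L by rewrite /L -e1; lra.
have r2 : 0 < r / 2 by rewrite divr_gt0.
rewrite -(ler_pM2l r2) mulrA (_ : r / 2 * (2 / r) = 1) ?mul1r //.
by field; rewrite gt_eqF.
Qed.

(** Every weak ultralimit [l] of [wbar] is a zero of [T] with [Cstar l = q]. A zero is recovered
    from its image as [f (C (Cstar l))], so all these limits equal [f (C q)]. *)
Lemma wbar_weak_cvg : zeros T !=set0 -> 2 < alpha ->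
  exists wstar, [/\ zeros T wstar, sv_fix (precond_resolvent M T) wstar &
    weakly_cvg wbar wstar].
Proof.
move=> [x0 Tx0] al2; have /andP[r0 _] := rho02.
have S0 : S (Cstar x0) = 0 by apply/relaxed_eq0; exists x0.
have a1' : 1 < a by rewrite /a; lra.
have [q [Sq hq]] := fast_KM_weak_cvg relaxed_coco a1 ac uE uhE zE a1' S0.
have [B hB] := iterates_bounded relaxed_coco a1 ac uE uhE zE S0.
have Sc := residual_cvg0 relaxed_coco a1 ac uE uhE zE S0.
have Jq : J q = q by apply/zeros_image/relaxed_eq0.
have Tq : T (f (C q)) 0 by have := reduced_graph q; rewrite Jq subrr linear0.
have [K hK] := wbar_bounded Tq hB.
exists (f (C q)); split => //; first exact: zero_precond_fix.
move=> v; apply: cvg_ultra => G UG FG.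
have [l hl] := weak_ultralimit UG hK.
have Jc : u k - J (u k) @[k --> \oo] --> (0 : U).
  have -> : (fun k => u k - J (u k)) = (fun k => rho^-1 *: S (u k)).
    by apply/funext => k; rewrite scalerA mulVf ?gt_eqF // scale1r.
  by rewrite -(scaler0 _ rho^-1); apply: cvgZ => //; exact: cvg_cst.
have rc : C (u k - J (u k)) @[k --> G] --> (0 : H).
  rewrite -(linear0 C); apply: continuous_cvg.
    exact: (linear_bounded_continuous C).1.
  by move=> A /Jc; exact: FG.
(* The graph points [(wbar k, C (u k - J (u k)))] converge weakly in the first component and
   strongly to [0] in the second. *)
have Tl : T l 0.
  apply: (maximal_monotone_mem maxT) => x y Txy; have [monT _] := maxT.
  have lim : inner (C (u k - J (u k))) (wbar k - x) - inner (wbar k - x) y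
      @[k --> G] --> 0 - inner (l - x) y.
    apply: cvgB.
      apply: (@inner_cvg0 _ _ _ _ _ _ _ (K + `|x|)) => // k.
      by apply: le_trans (ler_normB _ _) _; rewrite lerD2r.
    under eq_fun do rewrite innerDl.
    by rewrite innerDl; apply: cvgD => //; exact: cvg_cst.
  have := cvgr_to_ge lim (b := 0).
  rewrite !sub0r innerNr; apply; apply: filterE => k.
  have := monT _ _ _ _ (reduced_graph (u k)) Txy; rewrite -wbarE.
  by rewrite innerDr innerNr (innerC (C _)).
have Cl : Cstar l = q.
  apply: inner_inj => y; rewrite innerC (inner_adjoint adjC) (innerC y).
  have l1 : inner (wbar k) (C y) @[k --> G] --> inner l (C y) by exact: hl.
  have l2 : inner (wbar k) (C y) @[k --> G] --> inner q y.
    have -> : (fun k => inner (wbar k) (C y)) =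
        (fun k => inner (u k) y - inner (u k - J (u k)) y).
      apply/funext => k; rewrite -(inner_adjoint adjC) wbarE -/(J (u k)).
      by rewrite innerDl innerNl opprB addrC subrK.
    rewrite -[X in _ --> X]subr0; apply: cvgB.
      by move=> A /(hq y); exact: FG.
    by rewrite -(inner0l y); apply: inner_cvgl => A /Jc; exact: FG.
  by apply: (cvg_unique (@Rhausdorff R) l1); exact: l2.
have <- : l = f (C q) by rewrite -Cl sum_inv_zero.
exact: hl.
Qed.

End Main.

Theorem theorem2p7 (R : realType) (H U : hilbertType R)
    (T : H -> set H) (M : {linear H -> H})
    (C : {linear U -> H}) (Cstar : H -> U)
    (w0 : H) (alpha rho : R) (wbar what w : nat -> H) :
  maximal_monotone T ->
  zeros T !=set0 ->
  admissible_preconditioner M T ->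
  closed (range M) ->
  sv_continuous (sum_inv M T) ->
  bounded_operator C ->
  injective C ->
  is_adjoint C Cstar ->
  (forall x, M x = C (Cstar x)) ->
  2 <= alpha ->
  0 < rho <= 2 ->
  accelerated_dPPM M T alpha rho w0 wbar what w ->
  (alpha = 2 ->
     [/\ closed (Cstar @` zeros T),
         convex_set (Cstar @` zeros T) &
         exists p, exists wstar,
           [/\ projection (Cstar @` zeros T) (Cstar w0) = [set p],
               sum_inv M T (C p) = [set wstar],
               zeros T wstar /\ sv_fix (precond_resolvent M T) wstar,
               wbar n @[n --> \oo] --> wstar &
               rho < 2 -> w n @[n --> \oo] --> wstar /\
                          what n @[n --> \oo] --> wstar]]) /\
  (2 < alpha ->
     exists wstar,
       [/\ zeros T wstar,
           sv_fix (precond_resolvent M T) wstar &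
           weakly_cvg wbar wstar]).
Proof.
move=> maxT T0 admM clM [f fP fc] Cbd injC adjC MC alpha2 rho02 dPPM.
split=> al.
  split.
  - by eapply zeros_image_closed; eassumption.
  - by eapply zeros_image_convex_set; eassumption.
  - by eapply wbar_strong_cvg; eassumption.
by eapply wbar_weak_cvg; eassumption.
Qed.
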